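(* Let $X$ be an Oka-Stein manifold. The set of endomorphisms of $X$ with a non-pre-recurrent Fatou component is dense in $\operatorname{End} X$.
   Context: Oka-Stein manifolds. A complex manifold $X$ is Oka if it satisfies the following property (one of several equivalent definitions): whenever $S$ is a reduced Stein space, $K\subset S$ is a holomorphically convex compact subset, and $T\subset S$ is a closed analytic subvariety, every continuous map $S\to X$ that is holomorphic on a neighbourhood of $K\cup T$ can be deformed (through continuous maps) to a holomorphic map by a deformation that is arbitrarily small on $K$ and fixed to any given finite order along $T$. An Oka-Stein manifold is a complex manifold that is both Oka and Stein; it is taken to be connected and of positive dimension. $\operatorname{End} X$ is the monoid of endomorphisms of $X$, i.e. holomorphic maps $X\to X$, with the compact-open topology. The Fatou set $F_f$ of $f\in\operatorname{End} X$ is the set of points in $X$ with a neighbourhood $U$ such that every subsequence of the sequence of iterates of $f$ has a subsequence that converges locally uniformly on $U$ to a holomorphic map into $X$ or to the point at infinity. A Fatou component is a connected component of $F_f$. A Fatou component $U$ is pre-recurrent if some point $p\in U$ has an $\omega$-limit point in $F_f$, that is, some subsequence of $(f^n(p))$ converges to a point of $F_f$. *)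

(* Defs.v *)
(* The complex numbers are R[i] for R : realType, and
   C^n is 'rV[R[i]]_n with its normed-module structure over R[i]; thus
   [differentiable] between such spaces is complex (Frechet) differentiability,
   and a map is holomorphic near z iff it is differentiable at all points
   near z. *)
From HB Require Import structures.
From mathcomp Require Import all_boot all_order all_algebra.
From mathcomp Require Import all_classical all_reals all_analysis.
From mathcomp Require Import complex.

Set Implicit Arguments.
Unset Strict Implicit.
Unset Printing Implicit Defensive.
Import Order.TTheory GRing.Theory Num.Theory.
Import numFieldNormedType.Exports.

Local Open Scope classical_set_scope.
Local Open Scope ring_scope.
Local Open Scope complex_scope.

(* Makes R[i] a normed space over itself, with the metric given by its norm. *)
HB.instance Definition _ (R : realType) := NormedModule.copy R[i] (R[i]^o).

(* The values of [chart_map] outside [chart_dom] are irrelevant. *)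
Record chart (R : realType) (S : topologicalType) := Chart {
  chart_dim : nat;
  chart_dom : set S;
  chart_map :> S -> 'rV[R[i]]_chart_dim }.

Definition germ_holomorphic (R : realType) (n : nat) (W : normedModType R[i])
    (F : 'rV[R[i]]_n -> W) (a : 'rV[R[i]]_n) : Prop :=
  \forall z \near a, differentiable F z.

(* [A] is an analytic subset of some open subset of C^n: the open subset is a
   union of small neighbourhoods of the points of [A]. *)
Definition locally_analytic (R : realType) (n : nat) (A : set 'rV[R[i]]_n)
    : Prop :=
  forall a, A a -> exists (m : nat) (g : 'I_m -> 'rV[R[i]]_n -> R[i]),
    (forall i, germ_holomorphic (g i) a) /\
    (\forall z \near a, A z <-> forall i, g i z = 0).

(* A homeomorphism of an open subset of [S] onto a locally analytic subset. *)
Definition is_chart (R : realType) (S : topologicalType) (c : chart R S)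
    : Prop :=
  [/\ open (chart_dom c),
      forall p, chart_dom c p -> {for p, continuous c},
      set_inj (chart_dom c) c,
      forall U, open U -> U `<=` chart_dom c ->
        exists2 W, open W & c @` U = (c @` chart_dom c) `&` W
    & locally_analytic (c @` chart_dom c)].

(* The transition map from [c] to [d] is, locally, the restriction of a
   holomorphic map of the ambient spaces. *)
Definition charts_compatible (R : realType) (S : topologicalType)
    (c d : chart R S) : Prop :=
  forall p, chart_dom c p -> chart_dom d p ->
    exists F : 'rV[R[i]]_(chart_dim c) -> 'rV[R[i]]_(chart_dim d),
      germ_holomorphic F (c p) /\ \forall q \near p, d q = F (c q).

Record complex_space (R : realType) := ComplexSpace {
  space :> topologicalType;
  atlas : set (chart R space);
  space_hausdorff : hausdorff_space space;
  space_second_countable : @second_countable space;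
  atlas_chart : forall c, atlas c -> is_chart c;
  atlas_cover : forall p, exists2 c, atlas c & chart_dom c p;
  atlas_compatible : forall c d, atlas c -> atlas d -> charts_compatible c d }.

Section holomorphic.
Variable R : realType.
Implicit Types S X : complex_space R.

(* The germ of [f] at [p] is holomorphic; this is an open condition on [p]. *)
Definition fun_holomorphic_at S (f : S -> R[i]) (p : S) : Prop :=
  forall c, atlas c -> chart_dom c p ->
    exists F : 'rV[R[i]]_(chart_dim c) -> R[i],
      germ_holomorphic F (c p) /\ \forall q \near p, f q = F (c q).

Definition holomorphic_at S X (f : S -> X) (p : S) : Prop :=
  {for p, continuous f} /\
  forall (c : chart R S) (d : chart R X), atlas c -> atlas d ->
    chart_dom c p -> chart_dom d (f p) ->
    exists F : 'rV[R[i]]_(chart_dim c) -> 'rV[R[i]]_(chart_dim d),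
      germ_holomorphic F (c p) /\ \forall q \near p, d (f q) = F (c q).

Definition holomorphic_fun S (f : S -> R[i]) : Prop :=
  forall p, fun_holomorphic_at f p.

Definition holomorphic_map S X (f : S -> X) : Prop :=
  forall p, holomorphic_at f p.

(* Reduced complex spaces without singularities, of pure dimension [n]. *)
Definition complex_manifold (n : nat) X : Prop :=
  forall c : chart R X, atlas c ->
    chart_dim c = n /\ open (c @` chart_dom c).

(* For nonempty [K] the bounds [M : R[i]] are automatically real and
   nonnegative, so that the condition reads |f p| <= sup_K |f|. *)
Definition holomorphic_hull S (K : set S) : set S :=
  [set p | forall f : S -> R[i], holomorphic_fun f ->
    forall M : R[i], (forall q, K q -> `|f q| <= M) -> `|f p| <= M].

Definition holomorphically_convex S (K : set S) : Prop :=
  holomorphic_hull K = K.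

Definition stein S : Prop :=
  (forall K : set S, compact K -> compact (holomorphic_hull K)) /\
  (forall p q : S, p <> q ->
    exists2 f : S -> R[i], holomorphic_fun f & f p <> f q).

Definition closed_subvariety S (T : set S) : Prop :=
  forall p, exists (m : nat) (g : 'I_m -> S -> R[i]),
    (forall i, fun_holomorphic_at (g i) p) /\
    (\forall q \near p, T q <-> forall i, g i q = 0).

(* The germ of [h] at [p] lies in the [k]-th power of the ideal of germs of
   holomorphic functions vanishing on [T]. *)
Definition in_ideal_power S (T : set S) (k : nat) (p : S) (h : S -> R[i])
    : Prop :=
  exists (m : nat) (a : 'I_m -> S -> R[i]) (u : 'I_m -> 'I_k -> S -> R[i]),
    [/\ forall i, fun_holomorphic_at (a i) p,
        forall i j, fun_holomorphic_at (u i j) p,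
        forall i j, \forall q \near p, T q -> u i j q = 0
      & \forall q \near p, h q = \sum_(i < m) a i q * \prod_(j < k) u i j q].

(* [f] and [g] coincide on [T] and, in charts of [X], their difference lies in
   the power [k + 1] of the ideal of [T].  Since [f] is going to be holomorphic
   near [T], this forces [g] to be holomorphic near [T] as well. *)
Definition agree_to_order S X (k : nat) (T : set S) (f g : S -> X) : Prop :=
  forall p, T p -> f p = g p /\
    forall d : chart R X, atlas d -> chart_dom d (f p) ->
    forall j, in_ideal_power T k.+1 p (fun q => d (g q) ord0 j - d (f q) ord0 j).

(* Smallness of the deformation [H] on the compact set [K] is expressed by
   arbitrary neighbourhoods [V] of the graph of [f] over [K]; by compactness
   this is uniform closeness on [K] for any metric inducing the topology
   of [X]. *)
Definition oka X : Prop :=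
  forall S : complex_space R, stein S ->
  forall K : set S, compact K -> holomorphically_convex K ->
  forall T : set S, closed_subvariety T ->
  forall f : S -> X, continuous f ->
  (exists U : set S, [/\ open U, K `|` T `<=` U
                       & forall p, U p -> holomorphic_at f p]) ->
  forall (k : nat) (V : set (S * X)),
    open V -> (forall p, K p -> V (p, f p)) ->
  exists H : R * S -> X,
    [/\ {within `[0, 1]%classic `*` [set: S], continuous H},
        forall p, H (0, p) = f p,
        holomorphic_map (fun p => H (1, p)),
        forall t p, 0 <= t <= 1 -> K p -> V (p, H (t, p))
      & forall t, 0 <= t <= 1 -> agree_to_order k T f (fun p => H (t, p))].

Definition oka_stein_manifold X : Prop :=
  [/\ exists2 n, (0 < n)%N & complex_manifold n X,
      [set: X] !=set0,
      connected [set: X],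
      oka X
    & stein X].

Definition endomorphisms X : set {compact-open, X -> X} :=
  [set f | holomorphic_map (f : X -> X)].

(* For continuous [h] and open [U] this is locally uniform convergence on [U]
   for any metric inducing the topology of [X]. *)
Definition cvg_locally_uniformly X (U : set X) (g : nat -> X -> X)
    (h : X -> X) : Prop :=
  forall K O : set X, compact K -> K `<=` U -> open O -> h @` K `<=` O ->
    \forall n \near \oo, g n @` K `<=` O.

Definition cvg_locally_uniformly_to_infinity X (U : set X) (g : nat -> X -> X)
    : Prop :=
  forall K L : set X, compact K -> K `<=` U -> compact L ->
    \forall n \near \oo, g n @` K `<=` ~` L.

(* The limit [h] matters on [U] only. *)
Definition fatou_set X (f : X -> X) : set X :=
  [set p | exists U : set X, [/\ open U, U p &
    forall s : nat -> nat, increasing_seq s ->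
    exists2 t : nat -> nat, increasing_seq t &
      let g := fun n => iter (s (t n)) f in
      (exists2 h : X -> X, (forall q, U q -> holomorphic_at h q)
                         & cvg_locally_uniformly U g h)
      \/ cvg_locally_uniformly_to_infinity U g]].

Definition fatou_component X (f : X -> X) (U : set X) : Prop :=
  exists2 p, fatou_set f p & U = connected_component (fatou_set f) p.

Definition pre_recurrent X (f : X -> X) (U : set X) : Prop :=
  exists p q, [/\ U p, fatou_set f q &
    exists2 s : nat -> nat, increasing_seq s &
      (fun n => iter (s n) f p) @ \oo --> q].

End holomorphic.

Arguments endomorphisms {R} X.

(* Main.v *)
Require Import Defs.
From HB Require Import structures.
From mathcomp Require Import all_boot all_order all_algebra.
From mathcomp Require Import all_classical all_reals all_analysis.
From mathcomp Require Import complex.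
From mathcomp Require Import ring lra zify.

Set Implicit Arguments.
Unset Strict Implicit.
Unset Printing Implicit Defensive.
Import Order.TTheory GRing.Theory Num.Theory.
Import numFieldNormedType.Exports.
Local Open Scope classical_set_scope.
Local Open Scope ring_scope.

(** The idea is to give the approximating map a parabolic fixed point outside
    the compact set on which the approximation takes place.  Let [f] be the given
    endomorphism and [K] a holomorphically convex compact set.  A Stein manifold
    of positive dimension is not compact, so there is a point [p] outside [K].
    Near [p] consider, in local coordinates, the germ with components
    [x - x ^ 2 + x ^ 3].  Because [X] is connected, [f] can be changed near [p]
    to a continuous map which is this germ near [p] and still is [f] near [K]
    ([replace_near]).  The Oka property deforms it to an endomorphism [g] close to
    [f] on [K] which has the same Taylor polynomial of order three at [p]
    ([oka_interpolation]).

    In the coordinate [1 / x] the germ is the translation by [1] up to a summable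
    error ([inv_parabolic_step]).  Hence an open set of points, the petal, is
    attracted to [p] ([petal_attracted]), and lies in the Fatou set.  In the
    opposite direction there are points as close to [p] as desired whose orbits
    reach a fixed distance from [p] ([petal_backward]); therefore [p] is not in
    the Fatou set ([parabolic_not_fatou]).  By the identity theorem the whole
    Fatou component of the petal is attracted to [p]
    ([basin_interior_closed]): the only limit point of each of its orbits is [p],
    which is not in the Fatou set, so the component is not pre-recurrent.

    The facts of complex analysis used here are the identity theorem for maps
    into [X] and the strong maximum principle, which gives the noncompactness.
    Both are derived on complex lines in coordinates from one statement about a
    function [h] of one variable, differentiable at each point of a square except
    possibly one: its value at the centre is at most twice its maximum on the
    boundary ([center_value_le]).  The factor two is harmless, because the
    statement is applied to all powers of a function or to its quotients by all
    powers of a coordinate.  It follows from Goursat's lemma for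
    [h u / (u - z)].  Integrals are replaced by Riemann sums with [3 ^ n] points on
    each side of a square; these sums are exactly additive when a square is
    divided into nine, and vanish exactly for affine functions. *)

(** * Moduli as real numbers *)

Local Open Scope complex_scope.

Local Notation Re := complex.Re.
Local Notation Im := complex.Im.

(** The modulus as an element of [R], where linear arithmetic is available; the
    norm of [R[i]] takes its values in the partially ordered field [R[i]]. *)
Definition cnorm (R : realType) (z : R[i]) : R := Normc.normc z.
Local Notation N := cnorm.

Section cnorm.
Variable R : realType.
Implicit Types x y z w : R[i].

Lemma cnorm_ge0 z : 0 <= N z.
Proof. by case: z => a b; exact: sqrtr_ge0. Qed.

Lemma cnormD z w : N (z + w) <= N z + N w.
Proof. exact: (@le_normcD R z w). Qed.

Lemma cnormN z : N (- z) = N z.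
Proof. exact: (@normcN R z). Qed.

Lemma cnormBC z w : N (z - w) = N (w - z).
Proof. by rewrite -cnormN opprB. Qed.

Lemma cnormB z w : N (z - w) <= N z + N w.
Proof. by rewrite -(cnormN w); exact: cnormD. Qed.

Lemma cnorm_triangle z w y : N (z - y) <= N (z - w) + N (w - y).
Proof. by apply: le_trans (cnormD _ _); rewrite addrA subrK. Qed.

Lemma cnorm_lowerD z w : N z - N w <= N (z + w).
Proof. by have := cnormB (z + w) w; rewrite addrK lerBlDr. Qed.

Lemma cnorm_real (r : R) : N r%:C = `|r|.
Proof. by rewrite /cnorm /= expr0n /= addr0 sqrtr_sqr. Qed.

Lemma cnorm_i : N ('i : R[i]) = 1.
Proof. by rewrite /cnorm /= expr0n /= add0r expr1n sqrtr1. Qed.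

Lemma cnorm1 : N (1 : R[i]) = 1. Proof. exact: Normc.normc1. Qed.

Lemma cnorm0 : N (0 : R[i]) = 0. Proof. exact: Normc.normc0. Qed.

Lemma cnormM z w : N (z * w) = N z * N w. Proof. exact: Normc.normcM. Qed.

Lemma cnormV z : N z^-1 = (N z)^-1. Proof. exact: Normc.normcV. Qed.

Lemma cnorm_nat n : N (n%:R : R[i]) = n%:R.
Proof. by rewrite -(rmorph_nat (real_complex R)) cnorm_real normr_nat. Qed.

Lemma cnormX z n : N (z ^+ n) = N z ^+ n.
Proof.
by elim: n => [|n IH]; rewrite ?expr0 ?cnorm1 // !exprS cnormM IH.
Qed.

Lemma cnorm_div z w : N (z / w) = N z / N w.
Proof. by rewrite cnormM cnormV. Qed.

Lemma cnorm_eq0 z : (N z == 0) = (z == 0).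
Proof.
apply/eqP/eqP => [/Normc.eq0_normc//|->]; exact: cnorm0.
Qed.

Lemma cnorm_gt0 z : (0 < N z) = (z != 0).
Proof. by rewrite lt_def cnorm_ge0 andbT cnorm_eq0. Qed.

Lemma abs_Re_le_cnorm z : `|Re z| <= N z.
Proof.
case: z => a b; rewrite /cnorm /= -sqrtr_sqr ler_sqrt ?lerDl ?sqr_ge0 //.
by rewrite addr_ge0 ?sqr_ge0.
Qed.

Lemma abs_Im_le_cnorm z : `|Im z| <= N z.
Proof.
case: z => a b; rewrite /cnorm /= -sqrtr_sqr ler_sqrt ?lerDr ?sqr_ge0 //.
by rewrite addr_ge0 ?sqr_ge0.
Qed.

Lemma cnorm_le_ReIm z : N z <= `|Re z| + `|Im z|.
Proof.
case: z => a b; rewrite /cnorm /= -[leRHS]ger0_norm ?addr_ge0 // -sqrtr_sqr.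
rewrite ler_sqrt ?sqr_ge0 // sqrrD !real_normK ?num_real //.
have : 0 <= `|a| * `|b| by rewrite mulr_ge0.
lra.
Qed.

Lemma cnorm_sum (I : Type) (r : seq I) (P : pred I) (F : I -> R[i]) :
  N (\sum_(i <- r | P i) F i) <= \sum_(i <- r | P i) N (F i).
Proof.
elim/big_ind2 : _ => [|z a w b ha hb|//]; first by rewrite cnorm0.
by apply: le_trans (cnormD _ _) _; apply: lerD.
Qed.

End cnorm.

(** * Riemann sums over boundaries of squares *)

Section boundary_sums.
Variable R : realType.
Implicit Types (F G : R[i] -> R[i]) (w d z : R[i]) (s : R) (k : nat).

Definition edge_sum F w d k : R[i] :=
  \sum_(j < k) F (w + d * (j%:R / k%:R)) * (d / k%:R).

Definition boundary_sum F w s k : R[i] :=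
  edge_sum F w s%:C k + edge_sum F (w + s%:C) ('i * s%:C) k
  - edge_sum F (w + 'i * s%:C) s%:C k - edge_sum F w ('i * s%:C) k.

Definition in_square w s : set R[i] := [set z |
  [/\ Re w <= Re z, Re z <= Re w + s, Im w <= Im z & Im z <= Im w + s]].

Definition subcorner w s (a b : nat) : R[i] :=
  w + a%:R * (s / 3)%:C + b%:R * ('i * (s / 3)%:C).

Lemma edge_sum_triple F w d k : (0 < k)%N ->
  edge_sum F w (d + (d + d)) (k + (k + k)) =
  edge_sum F w d k + edge_sum F (w + d) d k + edge_sum F (w + d + d) d k.
Proof.
move=> k0; have kn0 : (k%:R : R[i]) != 0 by rewrite pnatr_eq0 -lt0n.
rewrite {1}/edge_sum !big_split_ord /= !natrD.
have -> : k%:R + (k%:R + k%:R) = 3 * k%:R :> R[i] by ring.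
have -> : (d + (d + d)) / (3 * k%:R) = d / k%:R by field.
rewrite -addrA; congr (_ + (_ + _)); apply: eq_bigr => j _;
  congr (F _ * _); rewrite ?natrD; field; exact: kn0.
Qed.

Lemma boundary_sum_subdivide F w s k : (0 < k)%N ->
  boundary_sum F w s (3 * k) =
  \sum_(a < 3) \sum_(b < 3) boundary_sum F (subcorner w s a b) (s / 3) k.
Proof.
move=> k0; have -> : (3 * k)%N = (k + (k + k))%N by lia.
rewrite !big_ord_recr !big_ord0 /= /subcorner /boundary_sum.
have -> : s%:C = (s / 3)%:C + ((s / 3)%:C + (s / 3)%:C) :> R[i].
  by rewrite -!rmorphD /=; congr (_%:C); field.
set t := (s / 3)%:C.
rewrite !mulrDr !edge_sum_triple //.
rewrite !mul0r !mul1r !addr0 !add0r !mulr_natl !mulr2n !addrA.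
move: ('i * t) => u.
have swap p : p + u + t = p + t + u by rewrite addrAC.
rewrite !swap.
ring.
Qed.

Definition square_boundary w s : set R[i] := [set z | in_square w s z /\
  [\/ Re z = Re w, Re z = Re w + s, Im z = Im w | Im z = Im w + s]].

Lemma edge_sumB F G w d k :
  edge_sum (fun z => F z - G z) w d k = edge_sum F w d k - edge_sum G w d k.
Proof.
by rewrite /edge_sum -sumrB; apply: eq_bigr => j _; rewrite mulrBl.
Qed.

Lemma boundary_sumB F G w s k :
  boundary_sum (fun z => F z - G z) w s k =
  boundary_sum F w s k - boundary_sum G w s k.
Proof. by rewrite /boundary_sum !edge_sumB; ring. Qed.

Lemma edge_sumZ (c : R[i]) F w d k :
  edge_sum (fun z => c * F z) w d k = c * edge_sum F w d k.
Proof.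
by rewrite /edge_sum mulr_sumr; apply: eq_bigr => j _; rewrite [RHS]mulrA.
Qed.

Lemma boundary_sumZ (c : R[i]) F w s k :
  boundary_sum (fun z => c * F z) w s k = c * boundary_sum F w s k.
Proof. by rewrite /boundary_sum !edge_sumZ; ring. Qed.

Lemma edge_sum_affine (c l : R[i]) w d k : (0 < k)%N ->
  edge_sum (fun z => c + l * z) w d k =
  c * d + l * (w * d + d ^+ 2 * \sum_(j < k) (j%:R / k%:R ^+ 2)).
Proof.
move=> k0; have kn0 : (k%:R : R[i]) != 0 by rewrite pnatr_eq0 -lt0n.
have E : d = \sum_(j < k) (d / k%:R).
  by rewrite big_const_ord iter_addr_0 -mulr_natr; field.
transitivity (\sum_(j < k) (c + l * w) * (d / k%:R)
   + \sum_(j < k) l * d ^+ 2 * (j%:R / k%:R ^+ 2)).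
  by rewrite -big_split /=; apply: eq_bigr => j _; field.
rewrite -[X in X + _]mulr_sumr -[X in _ + X]mulr_sumr -E.
by ring.
Qed.

(** Left Riemann sums on opposite sides use corresponding sample points, so
    that the cancellation for affine functions is exact and not merely
    approximate. *)
Lemma boundary_sum_affine (c l : R[i]) w s k : (0 < k)%N ->
  boundary_sum (fun z => c + l * z) w s k = 0.
Proof. by move=> k0; rewrite /boundary_sum !edge_sum_affine //; ring. Qed.

Lemma edge_sum_le F w d k (M : R) : (0 < k)%N ->
  (forall t : R, 0 <= t <= 1 -> N (F (w + d * t%:C)) <= M) ->
  N (edge_sum F w d k) <= N d * M.
Proof.
move=> k0 FM; have kR0 : (0 : R) < k%:R by rewrite ltr0n.
apply: le_trans (cnorm_sum _ _ _) _.
have -> : N d * M = \sum_(j < k) N d * M / k%:R.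
  by rewrite sumr_const card_ord -[RHS]mulr_natr; field; rewrite gt_eqF.
apply: ler_sum => j _; rewrite cnormM cnorm_div cnorm_nat mulrCA -mulrA.
rewrite ler_wpM2l ?cnorm_ge0 // ler_wpM2r ?invr_ge0 ?ler0n //.
have -> : j%:R / k%:R = (j%:R / k%:R)%:C :> R[i].
  by rewrite rmorphM fmorphV /= !rmorph_nat.
apply: FM; rewrite divr_ge0 ?ler0n //= ler_pdivrMr // mul1r ler_nat.
exact: ltnW.
Qed.

Lemma boundary_sum_le F w s k (M : R) : (0 < k)%N -> 0 <= s ->
  (forall z, square_boundary w s z -> N (F z) <= M) ->
  N (boundary_sum F w s k) <= 4 * s * M.
Proof.
move=> k0 s0 FM; rewrite /boundary_sum.
have Ns : N (s%:C) = s by rewrite cnorm_real ger0_norm.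
have Nis : N ('i * s%:C) = s by rewrite cnormM Ns cnorm_i mul1r.
have E1 : N (edge_sum F w s%:C k) <= s * M.
  rewrite -[X in X * M]Ns; apply: edge_sum_le => // t /andP[t0 t1]; apply: FM.
  have ts : 0 <= s * t by exact: mulr_ge0.
  have ts' : s * t <= s by rewrite ler_piMr.
  by split; [|apply: Or43]; rewrite /in_square /=; case: (w) => x y /=; simpc;
    rewrite /= ?mulr0 ?mul0r ?addr0 ?subr0; [split|]; lra.
have E2 : N (edge_sum F (w + s%:C) ('i * s%:C) k) <= s * M.
  rewrite -[X in X * M]Nis; apply: edge_sum_le => // t /andP[t0 t1]; apply: FM.
  have ts : 0 <= s * t by exact: mulr_ge0.
  have ts' : s * t <= s by rewrite ler_piMr.
  by split; [|apply: Or42]; rewrite /in_square /=; case: (w) => x y /=; simpc;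
    rewrite /= ?mulr0 ?mul0r ?addr0 ?subr0; [split|]; lra.
have E3 : N (edge_sum F (w + 'i * s%:C) s%:C k) <= s * M.
  rewrite -[X in X * M]Ns; apply: edge_sum_le => // t /andP[t0 t1]; apply: FM.
  have ts : 0 <= s * t by exact: mulr_ge0.
  have ts' : s * t <= s by rewrite ler_piMr.
  by split; [|apply: Or44]; rewrite /in_square /=; case: (w) => x y /=; simpc;
    rewrite /= ?mulr0 ?mul0r ?addr0 ?subr0; [split|]; lra.
have E4 : N (edge_sum F w ('i * s%:C) k) <= s * M.
  rewrite -[X in X * M]Nis; apply: edge_sum_le => // t /andP[t0 t1]; apply: FM.
  have ts : 0 <= s * t by exact: mulr_ge0.
  have ts' : s * t <= s by rewrite ler_piMr.
  by split; [|apply: Or41]; rewrite /in_square /=; case: (w) => x y /=; simpc;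
    rewrite /= ?mulr0 ?mul0r ?addr0 ?subr0; [split|]; lra.
have := cnormB (edge_sum F w s%:C k + edge_sum F (w + s%:C) ('i * s%:C) k
  - edge_sum F (w + 'i * s%:C) s%:C k) (edge_sum F w ('i * s%:C) k).
have := cnormB (edge_sum F w s%:C k + edge_sum F (w + s%:C) ('i * s%:C) k)
  (edge_sum F (w + 'i * s%:C) s%:C k).
have := cnormD (edge_sum F w s%:C k) (edge_sum F (w + s%:C) ('i * s%:C) k).
lra.
Qed.

(** * Subdivision of squares *)

Lemma nested_intervals (x y : nat -> R) :
  (forall n, x n <= x n.+1) -> (forall n, y n.+1 <= y n) ->
  (forall n, x n <= y n) -> exists c, forall n, x n <= c <= y n.
Proof.
move=> xi yd xy.
have xm : {homo x : m n / (m <= n)%N >-> m <= n}.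
  by apply: homo_leq => //; exact: le_trans.
have ym m n : (m <= n)%N -> y n <= y m.
  elim: n => [|n IH]; first by rewrite leqn0 => /eqP ->.
  rewrite leq_eqVlt => /predU1P[->//|/IH]; exact: le_trans (yd n).
have xym m n : x m <= y n.
  have [mn|/ltnW nm] := leqP m n; first exact: le_trans (xm _ _ mn) (xy n).
  exact: le_trans (xy m) (ym _ _ nm).
exists (sup (range x)) => n; apply/andP; split.
  apply: ub_le_sup; last by exists n.
  by exists (y 0) => _ [m _ <-].
by apply: ge_sup; [exists (x 0), 0|move=> _ [m _ <-]].
Qed.

Lemma exists_small_power (s d : R) : 0 < d -> exists n, s / 3 ^+ n < d.
Proof.
move=> d0; have hn := archi_boundP (normr_ge0 (s / d)).
set n := Num.Def.archi_bound _ in hn; exists n.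
have {}hn : s / d < n%:R by apply: le_lt_trans hn; exact: ler_norm.
have h3 : (n%:R : R) <= 3 ^+ n.
  by rewrite -natrX ler_nat; elim: (n) => // m; rewrite expnS; lia.
rewrite ltr_pdivrMr ?exprn_gt0 // mulrC -ltr_pdivrMr //.
exact: lt_le_trans hn h3.
Qed.

(** Every gauge on a closed square admits a tagged subdivision: if a property
    of squares passes from the nine subsquares to the square but failed for the
    square, it would fail for nested squares shrinking to a point. *)
Lemma square_subdivision_ind (P : R[i] -> R -> Prop) w0 s0 : 0 < s0 ->
  (forall w s, 0 < s ->
    (forall a b, (a < 3)%N -> (b < 3)%N -> P (subcorner w s a b) (s / 3)) ->
    P w s) ->
  (forall z, in_square w0 s0 z -> exists2 d, 0 < d &
    forall w s, 0 < s -> s < d -> in_square w s z -> P w s) ->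
  P w0 s0.
Proof.
move=> s00 Psub Ploc; apply: contrapT => nP.
have /choice[f fP] : forall q : R[i] * R, exists ab : nat * nat,
    0 < q.2 -> ~ P q.1 q.2 -> [/\ (ab.1 < 3)%N, (ab.2 < 3)%N &
      ~ P (subcorner q.1 q.2 ab.1 ab.2) (q.2 / 3)].
  move=> [w s] /=; have [s1|s1] := boolP (0 < s); last by exists (0, 0)%N.
  have [Pw|nPw] := pselect (P w s); first by exists (0, 0)%N.
  apply: contrapT => nex; apply: nPw; apply: Psub => // a b a3 b3.
  by apply: contrapT => nPab; apply: nex; exists (a, b).
pose q := fun n => iter n
  (fun q : R[i] * R => (subcorner q.1 q.2 (f q).1 (f q).2, q.2 / 3)) (w0, s0).
have q2 n : (q n).2 = s0 / 3 ^+ n.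
  elim: n => [|n IH] /=; first by rewrite expr0 divr1.
  by rewrite -/(q n) IH exprS; field; rewrite expf_neq0.
have q20 n : 0 < (q n).2 by rewrite q2 divr_gt0 ?exprn_gt0.
have nPq n : ~ P (q n).1 (q n).2.
  elim: n => [//|n IH]; rewrite /= -/(q n).
  by have [] := fP (q n) (q20 n) IH.
have fq n : ((f (q n)).1 < 3)%N /\ ((f (q n)).2 < 3)%N.
  by have [] := fP (q n) (q20 n) (nPq n).
have Req n : Re (q n.+1).1 = Re (q n).1 + (f (q n)).1%:R * ((q n).2 / 3).
  rewrite /= -/(q n) /subcorner; case: (q n).1 => x y.
  rewrite -!(rmorph_nat (real_complex R)) /=; simpc => /=; lra.
have Imq n : Im (q n.+1).1 = Im (q n).1 + (f (q n)).2%:R * ((q n).2 / 3).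
  rewrite /= -/(q n) /subcorner; case: (q n).1 => x y.
  rewrite -!(rmorph_nat (real_complex R)) /=; simpc => /=; lra.
have q2S n : (q n.+1).2 = (q n).2 / 3 by [].
have le2 m : (m < 3)%N -> (0 <= m%:R :> R) /\ (m%:R <= 2 :> R).
  by move=> m3; rewrite ler0n ler_nat.
have [x xP] : exists c, forall n, Re (q n).1 <= c <= Re (q n).1 + (q n).2.
  apply: nested_intervals => n; last by rewrite lerDl ltW.
    rewrite Req lerDl mulr_ge0 ?ler0n // divr_ge0 // ltW //.
  rewrite Req q2S; have [/le2[_ h] _] := fq n; have := q20 n; nra.
have [y yP] : exists c, forall n, Im (q n).1 <= c <= Im (q n).1 + (q n).2.
  apply: nested_intervals => n; last by rewrite lerDl ltW.
    rewrite Imq lerDl mulr_ge0 ?ler0n // divr_ge0 // ltW //.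
  rewrite Imq q2S; have [_ /le2[_ h]] := fq n; have := q20 n; nra.
have inq n : in_square (q n).1 (q n).2 (x +i* y).
  by have /andP[? ?] := xP n; have /andP[? ?] := yP n; split.
have [d d0 dP] := Ploc _ (inq 0).
have [n nd] := exists_small_power s0 d0.
by apply: (nPq n); apply: dP => //; rewrite q2.
Qed.

(** * Goursat's lemma *)

(** Complex differentiability and continuity in a form which involves real
    inequalities only. *)
Definition cdiff F z := exists l : R[i], forall e : R, 0 < e ->
  exists2 d : R, 0 < d &
    forall w, N (w - z) < d -> N (F w - F z - l * (w - z)) <= e * N (w - z).

Definition ccont F z := forall e : R, 0 < e ->
  exists2 d : R, 0 < d & forall w, N (w - z) < d -> N (F w - F z) <= e.

(** A primitive of [|x| ^ (-1/2) / 2].  Products of its increments give an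
    additive function of squares which is at least the side for every square
    around the origin. *)
Definition signed_sqrt (x : R) : R := Num.sqrt x - Num.sqrt (- x).

Lemma signed_sqrt_homo x y : x <= y -> signed_sqrt x <= signed_sqrt y.
Proof.
move=> xy; rewrite lerB //; apply: ler_wsqrtr => //.
by rewrite lerN2.
Qed.

Lemma signed_sqrt_increment x s : x <= 0 -> 0 <= x + s -> 0 <= s ->
  Num.sqrt s <= signed_sqrt (x + s) - signed_sqrt x.
Proof.
move=> x0 xs0 s0; rewrite /signed_sqrt.
rewrite (ler0_sqrtr x0) (ler0_sqrtr (_ : - (x + s) <= 0)) ?oppr_le0 //.
rewrite subr0 sub0r opprK.
have a0 := sqrtr_ge0 (x + s); have b0 := sqrtr_ge0 (- x).
rewrite -(@ler_pXn2r _ 2) ?nnegrE ?addr_ge0 ?sqrtr_ge0 //.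
rewrite sqrrD !sqr_sqrtr ?oppr_ge0 //.
have := mulr_ge0 a0 b0; lra.
Qed.

Definition square_weight z w s : R := s ^+ 2 +
  (signed_sqrt (Re w - Re z + s) - signed_sqrt (Re w - Re z)) *
  (signed_sqrt (Im w - Im z + s) - signed_sqrt (Im w - Im z)).

Lemma Re_subcorner w s a b : Re (subcorner w s a b) = Re w + a%:R * (s / 3).
Proof.
rewrite /subcorner; case: w => x y.
rewrite -!(rmorph_nat (real_complex R)) /=; simpc => /=; lra.
Qed.

Lemma Im_subcorner w s a b : Im (subcorner w s a b) = Im w + b%:R * (s / 3).
Proof.
rewrite /subcorner; case: w => x y.
rewrite -!(rmorph_nat (real_complex R)) /=; simpc => /=; lra.
Qed.

Lemma square_weight_subdivide z w s : square_weight z w s =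
  \sum_(a < 3) \sum_(b < 3) square_weight z (subcorner w s a b) (s / 3).
Proof.
pose g (a : nat) := signed_sqrt (Re w - Re z + a%:R * (s / 3)).
pose h (b : nat) := signed_sqrt (Im w - Im z + b%:R * (s / 3)).
transitivity (\sum_(a < 3) \sum_(b < 3)
    ((s / 3) ^+ 2 + (g a.+1 - g a) * (h b.+1 - h b))).
  rewrite !big_ord_recr !big_ord0 /= /square_weight.
  have -> : Re w - Re z + s = Re w - Re z + 3%:R * (s / 3) by field.
  have -> : Im w - Im z + s = Im w - Im z + 3%:R * (s / 3) by field.
  have -> : signed_sqrt (Re w - Re z) = g 0 by rewrite /g mul0r addr0.
  have -> : signed_sqrt (Im w - Im z) = h 0 by rewrite /h mul0r addr0.
  by rewrite -/(g 3) -/(h 3); field.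
apply: eq_bigr => a _; apply: eq_bigr => b _; rewrite /square_weight.
rewrite Re_subcorner Im_subcorner /g /h.
by congr (_ + (signed_sqrt _ - signed_sqrt _) * (signed_sqrt _ - signed_sqrt _));
  rewrite -?natr1; ring.
Qed.

Lemma square_weight_ge z w s : 0 <= s -> s ^+ 2 <= square_weight z w s.
Proof.
move=> s0; rewrite lerDl mulr_ge0 // subr_ge0; apply: signed_sqrt_homo; lra.
Qed.

Lemma square_weight_ge_side z w s : 0 <= s -> in_square w s z ->
  s <= square_weight z w s.
Proof.
move=> s0 [x1 x2 y1 y2]; rewrite /square_weight.
have h1 : Num.sqrt s <=
    signed_sqrt (Re w - Re z + s) - signed_sqrt (Re w - Re z).
  by apply: signed_sqrt_increment => //; lra.
have h2 : Num.sqrt s <=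
    signed_sqrt (Im w - Im z + s) - signed_sqrt (Im w - Im z).
  by apply: signed_sqrt_increment => //; lra.
have := ler_pM (sqrtr_ge0 s) (sqrtr_ge0 s) h1 h2.
rewrite -expr2 sqr_sqrtr //; have := sqr_ge0 s; lra.
Qed.

Lemma in_square_dist w s z u : in_square w s z -> in_square w s u ->
  N (u - z) <= 2 * s.
Proof.
move=> [x1 x2 y1 y2] [x1' x2' y1' y2']; apply: le_trans (cnorm_le_ReIm _) _.
case: z u w x1 x2 y1 y2 x1' x2' y1' y2' => [a b] [c d] [x y] /=.
move=> *; have : `|c - a| <= s by rewrite ler_norml; lra.
have : `|d - b| <= s by rewrite ler_norml; lra.
lra.
Qed.

Lemma cdiff_ccont F z : cdiff F z -> ccont F z.
Proof.
move=> [l lP] e e0; have [d d0 dP] := lP 1 ltr01.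
have k0 : 0 < 1 + N l by have := cnorm_ge0 l; lra.
exists (Num.min d (e / (1 + N l))) => [|w].
  by rewrite lt_min d0 divr_gt0.
rewrite lt_min => /andP[/dP h1]; rewrite ltr_pdivlMr // => h2.
have := cnormD (F w - F z - l * (w - z)) (l * (w - z)).
rewrite subrK cnormM; have := cnorm_ge0 (w - z); lra.
Qed.

(** Goursat's lemma.  The exceptional point, where only continuity is assumed,
    is absorbed by the second term of [square_weight]. *)
Lemma goursat F w0 s0 z0 : 0 < s0 ->
  (forall z, in_square w0 s0 z -> ccont F z) ->
  (forall z, in_square w0 s0 z -> z <> z0 -> cdiff F z) ->
  forall e : R, 0 < e -> exists n0, forall n, (n0 <= n)%N ->
    N (boundary_sum F w0 s0 (3 ^ n)) <= e.
Proof.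
move=> s00 Fc Fd e e0.
have pow n : (0 < 3 ^ n)%N by rewrite expn_gt0.
set m := square_weight z0 w0 s0.
have m0 : 0 < m.
  by apply: lt_le_trans (square_weight_ge z0 w0 (ltW s00)); rewrite exprn_gt0.
set eta := e / m; have eta0 : 0 < eta by rewrite divr_gt0.
have -> : e = eta * m by rewrite /eta; field; rewrite gt_eqF.
pose P w s := exists n0, forall n, (n0 <= n)%N ->
  N (boundary_sum F w s (3 ^ n)) <= eta * square_weight z0 w s.
apply: (@square_subdivision_ind P) => // [w s s_gt0 Psub|z zw0].
  have /choice[n1 n1P] : forall ab : 'I_3 * 'I_3, exists n0, forall n,
      (n0 <= n)%N ->
      N (boundary_sum F (subcorner w s ab.1 ab.2) (s / 3) (3 ^ n)) <=
      eta * square_weight z0 (subcorner w s ab.1 ab.2) (s / 3).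
    by move=> [a b]; exact: Psub.
  exists (\max_ab n1 ab).+1 => -[//|n]; rewrite ltnS => nle.
  rewrite expnS boundary_sum_subdivide // square_weight_subdivide mulr_sumr.
  apply: le_trans (cnorm_sum _ _ _) _; apply: ler_sum => a _.
  rewrite mulr_sumr.
  apply: le_trans (cnorm_sum _ _ _) _; apply: ler_sum => b _.
  apply: (n1P (a, b)); apply: leq_trans nle.
  exact: (@leq_bigmax _ n1 (a, b)).
have [zz0|/eqP zz0] := eqVneq z z0.
  have [d d0 dP] := Fc _ zw0 _ (divr_gt0 eta0 (ltac:(lra) : 0 < 4 :> R)).
  exists (d / 2) => [|w s s_gt0 sd zws]; first by rewrite divr_gt0.
  exists 0%N => n _.
  have E : boundary_sum F w s (3 ^ n) =
      boundary_sum (fun u => F u - (F z + 0 * u)) w s (3 ^ n).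
    by rewrite boundary_sumB boundary_sum_affine // subr0.
  rewrite E; apply: (@le_trans _ _ (4 * s * (eta / 4))).
    apply: boundary_sum_le => // [|u [us _]]; first exact: ltW.
    rewrite mul0r addr0; apply: dP.
    apply: le_lt_trans (in_square_dist zws us) _; lra.
  rewrite zz0 in zws.
  have := square_weight_ge_side (ltW s_gt0) zws; rewrite -(ler_pM2l eta0); lra.
have [l lP] := Fd _ zw0 zz0.
have [d d0 dP] := lP _ (divr_gt0 eta0 (ltac:(lra) : 0 < 8 :> R)).
exists (d / 2) => [|w s s_gt0 sd zws]; first by rewrite divr_gt0.
exists 0%N => n _.
have E : boundary_sum F w s (3 ^ n) =
    boundary_sum (fun u => F u - (F z - l * z + l * u)) w s (3 ^ n).
  by rewrite boundary_sumB boundary_sum_affine // subr0.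
rewrite E; apply: (@le_trans _ _ (4 * s * (eta / 8 * (2 * s)))).
  apply: boundary_sum_le => // [|u [us _]]; first exact: ltW.
  have := in_square_dist zws us => us2.
  have -> : F u - (F z - l * z + l * u) = F u - F z - l * (u - z) by ring.
  apply: le_trans (dP _ _) _; first by apply: le_lt_trans us2 _; lra.
  by rewrite ler_wpM2l // divr_ge0 // ltW.
have := square_weight_ge z0 w (ltW s_gt0); rewrite -(ler_pM2l eta0) expr2; lra.
Qed.

(** * The winding sum *)

Definition corner z (r : R) : R[i] := z - r%:C - 'i * r%:C.

Definition csquare z r := in_square (corner z r) (2 * r).

Lemma csquareP z r u : csquare z r u <->
  (`|Re u - Re z| <= r /\ `|Im u - Im z| <= r).
Proof.
rewrite /csquare /in_square /corner; case: z u => [a b] [c d] /=; simpc => /=.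
rewrite !ler_norml; split=> [[h1 h2 h3 h4]|[/andP[h1 h2] /andP[h3 h4]]].
  by split; apply/andP; split; lra.
by split; lra.
Qed.

Lemma csquare_cnorm z r u : N (u - z) <= r -> csquare z r u.
Proof.
move=> ur; apply/csquareP; split.
  have := abs_Re_le_cnorm (u - z); case: u z {ur} (ur) => [? ?] [? ?] /=; lra.
have := abs_Im_le_cnorm (u - z); case: u z {ur} (ur) => [? ?] [? ?] /=; lra.
Qed.

Lemma csquare_dist z r u : csquare z r u -> N (u - z) <= 2 * r.
Proof.
move=> /csquareP[h1 h2]; apply: le_trans (cnorm_le_ReIm _) _.
by case: u z h1 h2 => [? ?] [? ?] /=; lra.
Qed.

Lemma csquare_boundary_dist z r u :
  square_boundary (corner z r) (2 * r) u -> r <= N (u - z).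
Proof.
move=> [_]; rewrite /corner => h.
have hR := abs_Re_le_cnorm (u - z); have hI := abs_Im_le_cnorm (u - z).
case: z u h hR hI => [a b] [c d] /=; simpc => /= h; rewrite !ler_norml.
by move=> /andP[? ?] /andP[? ?]; case: h; lra.
Qed.

Lemma edge_sum_inv_ge (g : R) z w d k : (0 < k)%N ->
  (forall t : R, 0 <= t <= 1 -> 1 <= g * Im ((w + d * t%:C - z)^-1 * d)) ->
  1 <= g * Im (edge_sum (fun u => (u - z)^-1) w d k).
Proof.
move=> k0 ge1; have kR0 : (0 : R) < k%:R by rewrite ltr0n.
have -> : Im (edge_sum (fun u => (u - z)^-1) w d k) =
    \sum_(j < k) Im ((w + d * (j%:R / k%:R)%:C - z)^-1 * d) / k%:R.
  have ImD : {morph @complex.Im R : x y / x + y} by move=> [? ?] [? ?].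
  rewrite /edge_sum (big_morph (@complex.Im R) ImD (erefl : Im 0 = 0)).
  apply: eq_bigr => j _.
  have -> : j%:R / k%:R = (j%:R / k%:R)%:C :> R[i].
    by rewrite rmorphM fmorphV /= !rmorph_nat.
  have -> : k%:R = k%:R%:C :> R[i] by rewrite rmorph_nat.
  rewrite mulrA -fmorphV /=; case: (_ * d) => x y; simpc => /=; ring.
have E : 1 = \sum_(j < k) (k%:R^-1 : R).
  by rewrite sumr_const card_ord -[RHS]mulr_natr mulVf // gt_eqF.
rewrite [leLHS]E mulr_sumr; apply: ler_sum => j _.
rewrite mulrA ler_peMl ?invr_ge0 ?ler0n //; apply: ge1.
rewrite divr_ge0 ?ler0n //= ler_pdivrMr // mul1r ler_nat; exact: ltnW.
Qed.

(** Each side of the square contributes at least [1] to the imaginary part of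
    the sum for [1 / (u - z)], as a quarter turn around [z] should. *)
Lemma winding_sum_ge z r k : (0 < k)%N -> 0 < r ->
  4 <= N (boundary_sum (fun u => (u - z)^-1) (corner z r) (2 * r) k).
Proof.
move=> k0 r0; apply: le_trans (abs_Im_le_cnorm _).
apply: le_trans (ler_norm _).
have key x : - r <= x -> x <= r -> 1 <= 2 * r * (r / (x ^+ 2 + r ^+ 2)).
  move=> x1 x2; have p : 0 < x ^+ 2 + r ^+ 2.
    by rewrite ltr_wpDl ?sqr_ge0 ?exprn_gt0.
  rewrite mulrA ler_pdivlMr // mul1r.
  have : 0 <= (r - x) * (r + x) by rewrite mulr_ge0 //; lra.
  rewrite !expr2; lra.
have keyt t : 0 <= t <= 1 ->
    1 <= 2 * r * (r / ((2 * r * t - r) ^+ 2 + r ^+ 2)).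
  move=> /andP[t0 t1]; have b1 : 0 <= r * t by rewrite mulr_ge0 ?(ltW r0).
  have b2 : r * t <= r by rewrite ler_piMr // ltW.
  by apply: key; lra.
have sub1 x y : x - r + y - x = y - r by ring.
have sub2 x : x - r - x = - r by ring.
have sub3 x : x - r + 2 * r - x = r by ring.
have E1 : 1 <= 1 * Im (edge_sum (fun u => (u - z)^-1) (corner z r) (2 * r)%:C k).
  apply: edge_sum_inv_ge => // t /keyt/le_trans; apply.
  rewrite /corner; case: (z) => x y; simpc => /=.
  by rewrite sub1 sub2 sqrrN le_eqVlt; apply/orP; left; apply/eqP; ring.
have E2 : 1 <= 1 * Im (edge_sum (fun u => (u - z)^-1)
    (corner z r + (2 * r)%:C) ('i * (2 * r)%:C) k).
  apply: edge_sum_inv_ge => // t /keyt/le_trans; apply.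
  rewrite /corner; case: (z) => x y; simpc => /=.
  rewrite sub3 sub1 [r ^+ 2 + _]addrC le_eqVlt; apply/orP; left.
  by apply/eqP; ring.
have E3 : 1 <= -1 * Im (edge_sum (fun u => (u - z)^-1)
    (corner z r + 'i * (2 * r)%:C) (2 * r)%:C k).
  apply: edge_sum_inv_ge => // t /keyt/le_trans; apply.
  rewrite /corner; case: (z) => x y; simpc => /=.
  by rewrite sub3 sub1 le_eqVlt; apply/orP; left; apply/eqP; ring.
have E4 : 1 <= -1 * Im (edge_sum (fun u => (u - z)^-1)
    (corner z r) ('i * (2 * r)%:C) k).
  apply: edge_sum_inv_ge => // t /keyt/le_trans; apply.
  rewrite /corner; case: (z) => x y; simpc => /=.
  rewrite sub1 sub2 sqrrN [r ^+ 2 + _]addrC le_eqVlt; apply/orP; left.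
  by apply/eqP; ring.
rewrite /boundary_sum.
move: (edge_sum _ _ _ _) (edge_sum _ _ _ _) (edge_sum _ _ _ _)
  (edge_sum _ _ _ _) E1 E2 E3 E4 => [? ?] [? ?] [? ?] [? ?] /=; simpc => /=.
lra.
Qed.

(** * Rules for complex derivatives *)

Lemma ccontM F G z : ccont F z -> ccont G z -> ccont (fun w => F w * G w) z.
Proof.
move=> Fc Gc e e0.
have nF := cnorm_ge0 (F z); have nG := cnorm_ge0 (G z).
set K := N (F z) + N (G z) + 1; have K0 : 0 < K by rewrite /K; lra.
set e1 := Num.min 1 (e / (2 * K)).
have e1_gt0 : 0 < e1 by rewrite lt_min ltr01 divr_gt0 //; lra.
have [d1 d10 F1] := Fc _ e1_gt0; have [d2 d20 G1] := Gc _ e1_gt0.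
exists (Num.min d1 d2) => [|w]; first by rewrite lt_min d10.
rewrite lt_min => /andP[/F1 f1 /G1 g1].
have -> : F w * G w - F z * G z =
    (F w - F z) * (G w - G z) + ((F w - F z) * G z + F z * (G w - G z)) by ring.
have e1_1 : e1 <= 1 by rewrite ge_min lexx.
have e1_K : e1 * (2 * K) <= e.
  by rewrite -ler_pdivlMr ?ge_min ?lexx ?orbT //; lra.
have p1 : N (F w - F z) * N (G w - G z) <= e1.
  apply: le_trans (ler_pM (cnorm_ge0 _) (cnorm_ge0 _) f1 g1) _.
  by rewrite ler_piMl // ltW.
have p2 := ler_wpM2r nG f1; have p3 := ler_wpM2l nF g1.
have h1 := cnormD ((F w - F z) * (G w - G z))
  ((F w - F z) * G z + F z * (G w - G z)).
have h2 := cnormD ((F w - F z) * G z) (F z * (G w - G z)).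
rewrite !cnormM in h1 h2; rewrite /K in e1_K; lra.
Qed.

Lemma cdiffM F G z : cdiff F z -> cdiff G z -> cdiff (fun w => F w * G w) z.
Proof.
move=> Fd Gd; have Gc := cdiff_ccont Gd.
case: Fd Gd => [l lP] [m mP]; exists (l * G z + F z * m) => e e0.
have nF := cnorm_ge0 (F z); have nG := cnorm_ge0 (G z); have nl := cnorm_ge0 l.
set K := N (F z) + N (G z) + N l + 1; have K0 : 0 < K by rewrite /K; lra.
set e1 := Num.min 1 (e / K).
have e1_gt0 : 0 < e1 by rewrite lt_min ltr01 divr_gt0.
have [d1 d10 F1] := lP _ e1_gt0; have [d2 d20 G1] := mP _ e1_gt0.
have [d3 d30 G2] := Gc _ e1_gt0.
exists (Num.min d1 (Num.min d2 d3)) => [|w]; first by rewrite !lt_min d10 d20.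
rewrite !lt_min => /and3P[/F1 f1 /G1 g1 /G2 g2].
have e1_1 : e1 <= 1 by rewrite ge_min lexx.
have e1_K : e1 * K <= e by rewrite -ler_pdivlMr ?ge_min ?lexx ?orbT.
have -> : F w * G w - F z * G z - (l * G z + F z * m) * (w - z) =
  (F w - F z - l * (w - z)) * G w + l * (w - z) * (G w - G z) +
  F z * (G w - G z - m * (w - z)) by ring.
have nw := cnorm_ge0 (w - z).
have gw : N (G w) <= N (G z) + 1.
  have := cnormD (G w - G z) (G z); rewrite subrK; lra.
have p1 : N (F w - F z - l * (w - z)) * N (G w) <=
    e1 * N (w - z) * (N (G z) + 1).
  by apply: ler_pM => //; exact: cnorm_ge0.
have p2 : N l * N (w - z) * N (G w - G z) <= N l * N (w - z) * e1.
  by rewrite ler_wpM2l // mulr_ge0.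
have p3 := ler_wpM2l nF g1.
have h1 := cnormD ((F w - F z - l * (w - z)) * G w + l * (w - z) * (G w - G z))
  (F z * (G w - G z - m * (w - z))).
have h2 := cnormD ((F w - F z - l * (w - z)) * G w) (l * (w - z) * (G w - G z)).
rewrite !cnormM in h1 h2; have := ler_wpM2r nw e1_K; rewrite /K; lra.
Qed.

Lemma cdiff_near F G z (d : R) : 0 < d ->
  (forall w, N (w - z) < d -> F w = G w) -> cdiff F z -> cdiff G z.
Proof.
move=> d0 FG [l lP]; exists l => e /lP[d1 d10 FP].
have Gz : F z = G z by apply: FG; rewrite subrr cnorm0.
exists (Num.min d d1) => [|w]; first by rewrite lt_min d0.
by rewrite lt_min => /andP[/FG <- /FP]; rewrite -Gz.
Qed.

Lemma cdiff_cst (c : R[i]) z : cdiff (fun=> c) z.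
Proof.
exists 0 => e e0; exists 1 => // w _; rewrite subrr mul0r subr0 cnorm0.
by rewrite mulr_ge0 ?cnorm_ge0 // ltW.
Qed.

Lemma cdiff_inv_sub a z : z <> a -> cdiff (fun w => (w - a)^-1) z.
Proof.
move=> /eqP za; have nz : z - a != 0 by rewrite subr_eq0.
set m := N (z - a); have m0 : 0 < m by rewrite cnorm_gt0.
exists (- (z - a) ^- 2) => e e0.
exists (Num.min (m / 2) (e * m ^+ 3 / 2)) => [|w].
  by rewrite lt_min !divr_gt0 // mulr_gt0 // exprn_gt0.
rewrite lt_min => /andP[w1 w2].
have mw : m / 2 <= N (w - a).
  have := cnormB (w - a) (w - z); rewrite (_ : w - a - (w - z) = z - a).
    by rewrite -/m; lra.
  by ring.
have mw0 : 0 < N (w - a) by apply: lt_le_trans mw; rewrite divr_gt0.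
have nw : w - a != 0 by rewrite -cnorm_gt0.
have -> : (w - a)^-1 - (z - a)^-1 - - (z - a) ^- 2 * (w - z) =
    (w - z) ^+ 2 / ((z - a) ^+ 2 * (w - a)) by field; rewrite nz nw.
rewrite cnorm_div cnormM !cnormX -/m ler_pdivrMr ?mulr_gt0 ?exprn_gt0 //.
have n0 := cnorm_ge0 (w - z).
have m2 : 0 < m ^+ 2 by rewrite exprn_gt0.
have : N (w - z) <= e * (m ^+ 2 * N (w - a)).
  have : e * (m ^+ 2 * (m / 2)) <= e * (m ^+ 2 * N (w - a)).
    by rewrite ler_pM2l // ler_pM2l.
  rewrite exprS in w2; lra.
move=> h; have := ler_wpM2l n0 h; rewrite !expr2; lra.
Qed.

Lemma cdiffX F z n : cdiff F z -> cdiff (fun w => F w ^+ n) z.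
Proof.
move=> Fz; elim: n => [|n IH].
  by have -> : (fun w => F w ^+ 0) = (fun=> 1) by []; exact: cdiff_cst.
have -> : (fun w => F w ^+ n.+1) = (fun w => F w * F w ^+ n).
  by apply: funext => w; rewrite exprS.
exact: cdiffM.
Qed.

(** * The maximum principle with an exceptional point *)

Lemma in_subsquare w s a b z : 0 <= s -> (a < 3)%N -> (b < 3)%N ->
  in_square (subcorner w s a b) (s / 3) z -> in_square w s z.
Proof.
move=> s0 a3 b3 [h1 h2 h3 h4]; rewrite Re_subcorner Im_subcorner in h1 h2 h3 h4.
have bnd n : (n < 3)%N -> 0 <= n%:R * (s / 3) /\ n%:R * (s / 3) <= 2 * (s / 3).
  move=> n3; split; first by rewrite mulr_ge0 ?ler0n ?divr_ge0.
  by rewrite ler_wpM2r ?divr_ge0 // ler_nat.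
have [a0 a2] := bnd a a3; have [b0 b2] := bnd b b3; split; lra.
Qed.

Lemma subcorner_center z r : subcorner (corner z r) (2 * r) 1 1 = corner z (r / 3).
Proof.
rewrite /subcorner /corner; case: z => x y; simpc => /=.
by congr (_ +i* _); field.
Qed.

Lemma center_notin_subsquare z r a b : 0 < r -> (a, b) <> (1, 1)%N ->
  (a < 3)%N -> (b < 3)%N ->
  ~ in_square (subcorner (corner z r) (2 * r) a b) (2 * r / 3) z.
Proof.
move=> r0 ab a3 b3; rewrite /in_square /= Re_subcorner Im_subcorner.
have [-> ->] : Re (corner z r) = Re z - r /\ Im (corner z r) = Im z - r.
  by rewrite /corner; case: z => x y; simpc.
move=> [h1 h2 h3 h4]; apply: ab.
move: a b a3 b3 h1 h2 h3 h4 => [|[|[|//]]] [|[|[|//]]] // _ _ h1 h2 h3 h4;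
  exfalso; lra.
Qed.

Lemma boundary_sum_shrink F z0 z r : 0 < r ->
  (forall u, csquare z r u -> u <> z -> ccont F u) ->
  (forall u, csquare z r u -> u <> z -> u <> z0 -> cdiff F u) ->
  forall e : R, 0 < e -> exists n0, forall n, (n0 <= n)%N ->
  N (boundary_sum F (corner z r) (2 * r) (3 ^ n.+1) -
     boundary_sum F (corner z (r / 3)) (2 * (r / 3)) (3 ^ n)) <= e.
Proof.
move=> r0 Fc Fd e e0.
have /choice[n1 n1P] : forall ab : 'I_3 * 'I_3, exists n0, forall n,
   (n0 <= n)%N -> (ab != (inord 1, inord 1)) ->
   N (boundary_sum F (subcorner (corner z r) (2 * r) ab.1 ab.2)
     (2 * r / 3) (3 ^ n)) <= e / 9.
  move=> ab; have [ab1|] := boolP (ab == (inord 1, inord 1)).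
    by exists 0%N.
  case: ab => a b /= ab.
  have sub u : in_square (subcorner (corner z r) (2 * r) a b) (2 * r / 3) u ->
      csquare z r u /\ u <> z.
    move=> hu; split; first by apply: in_subsquare hu; rewrite ?mulr_ge0 // ltW.
    move=> uz; move: hu; rewrite uz; apply: center_notin_subsquare => //.
    move=> [a1 b1]; move/eqP: ab; apply; congr (_, _);
      by apply: val_inj; rewrite /= inordK.
  have s0 : 0 < 2 * r / 3 by rewrite divr_gt0 ?mulr_gt0.
  have e9 : 0 < e / 9 by rewrite divr_gt0.
  have [n0 n0P] := goursat s0 (fun u hu => Fc u (sub u hu).1 (sub u hu).2)
    (fun u hu => Fd u (sub u hu).1 (sub u hu).2) e9.
  by exists n0 => n ln _; exact: n0P.
exists (\max_ab n1 ab) => n nle.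
have {}n1P (ab : 'I_3 * 'I_3) : ab != (inord 1, inord 1) ->
   N (boundary_sum F (subcorner (corner z r) (2 * r) ab.1 ab.2)
     (2 * r / 3) (3 ^ n)) <= e / 9.
  by apply: n1P; apply: leq_trans nle; exact: leq_bigmax.
rewrite expnS boundary_sum_subdivide ?expn_gt0 // pair_big /=.
rewrite (bigD1 (inord 1, inord 1)) //= !inordK // subcorner_center.
rewrite [2 * (r / 3)]mulrA addrAC subrr add0r.
apply: le_trans (cnorm_sum _ _ _) _.
apply: le_trans (ler_sum _ (fun ab => n1P ab)) _.
rewrite sumr_const -[leLHS]mulr_natr -[leRHS](@divfK _ 9) //.
rewrite ler_wpM2l ?divr_ge0 ?(ltW e0) // ler_nat.
by apply: leq_trans (max_card _) _; rewrite card_prod card_ord.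
Qed.

Lemma boundary_sum_shrink_iter F z0 z r j : 0 < r ->
  (forall u, csquare z r u -> u <> z -> ccont F u) ->
  (forall u, csquare z r u -> u <> z -> u <> z0 -> cdiff F u) ->
  forall e : R, 0 < e -> exists n0, forall n, (n0 <= n)%N ->
  N (boundary_sum F (corner z r) (2 * r) (3 ^ (n + j)) -
     boundary_sum F (corner z (r / 3 ^+ j)) (2 * (r / 3 ^+ j)) (3 ^ n)) <= e.
Proof.
elim: j r => [|j IH] r r0 Fc Fd e e0.
  exists 0%N => n _; rewrite addn0 expr0 divr1 subrr cnorm0; exact: ltW.
have e2 : 0 < e / 2 by lra.
have [n1 n1P] := boundary_sum_shrink r0 Fc Fd e2.
have r30 : 0 < r / 3 by lra.
have sub u : csquare z (r / 3) u -> csquare z r u.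
  by move=> /csquareP[? ?]; apply/csquareP; split; lra.
have [n2 n2P] := IH _ r30 (fun u hu => Fc u (sub u hu))
  (fun u hu => Fd u (sub u hu)) _ e2.
exists (maxn n1 n2) => n; rewrite geq_max => /andP[ln1 ln2].
have h1 := n1P (n + j)%N (leq_trans ln1 (leq_addr _ _)).
have h2 := n2P n ln2.
have -> : r / 3 ^+ j.+1 = r / 3 / 3 ^+ j.
  by rewrite exprS; field; rewrite expf_neq0.
rewrite addnS; apply: le_trans (cnorm_triangle _
  (boundary_sum F (corner z (r / 3)) (2 * (r / 3)) (3 ^ (n + j))) _) _.
lra.
Qed.

(** A maximum principle with one exceptional point.  The integral of
    [h u / (u - z)] over the boundary does not change when the square shrinks
    to [z], where it becomes [h z] times the winding integral. *)
Lemma center_value_le h z0 z r (M : R) : 0 < r ->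
  (forall u, csquare z r u -> ccont h u) ->
  (forall u, csquare z r u -> u <> z0 -> cdiff h u) ->
  (forall u, csquare z r u -> r <= N (u - z) -> N (h u) <= M) ->
  N (h z) <= 2 * M.
Proof.
move=> r0 hc hd hM; rewrite leNgt; apply/negP => Mlt.
set eta := (N (h z) - 2 * M) / 9; have eta0 : 0 < eta by rewrite /eta; lra.
pose F u := h u * (u - z)^-1.
have Fc u : csquare z r u -> u <> z -> ccont F u.
  move=> ur uz; apply: ccontM; first exact: hc.
  by apply: cdiff_ccont; exact: cdiff_inv_sub.
have Fd u : csquare z r u -> u <> z -> u <> z0 -> cdiff F u.
  by move=> ur uz uz0; apply: cdiffM; [exact: hd|exact: cdiff_inv_sub].
have zr : csquare z r z.
  by apply/csquareP; rewrite !subrr normr0; split; exact: ltW.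
have [d d0 dP] := hc _ zr _ eta0.
have [j jd] := @exists_small_power (2 * r) d d0.
have r30 : 0 < r / 3 ^+ j by rewrite divr_gt0 ?exprn_gt0.
have [n0 n0P] := boundary_sum_shrink_iter j r0 Fc Fd eta0.
have p3 m : (0 < 3 ^ m)%N by rewrite expn_gt0.
have {n0P} h1 := n0P n0 (leqnn _).
have h2 : N (boundary_sum F (corner z r) (2 * r) (3 ^ (n0 + j))) <= 8 * M.
  have -> : 8 * M = 4 * (2 * r) * (M / r) by field; rewrite gt_eqF.
  apply: boundary_sum_le => // [|u ur]; first lra.
  have ru := csquare_boundary_dist ur.
  rewrite /F cnormM cnormV; apply: ler_pM => //.
  - exact: cnorm_ge0.
  - by rewrite invr_ge0 cnorm_ge0.
  - by apply: hM => //; case: ur.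
  - by rewrite lef_pV2 // posrE //; exact: lt_le_trans ru.
set rj := r / 3 ^+ j in r30 h1.
have h3 : N (boundary_sum F (corner z rj) (2 * rj) (3 ^ n0) -
    h z * boundary_sum (fun u => (u - z)^-1) (corner z rj) (2 * rj) (3 ^ n0))
    <= 8 * eta.
  rewrite -boundary_sumZ -boundary_sumB.
  have -> : 8 * eta = 4 * (2 * rj) * (eta / rj) by field; rewrite gt_eqF.
  apply: boundary_sum_le => // [|u ur]; first lra.
  have ru := csquare_boundary_dist ur.
  rewrite /F -mulrBl cnormM cnormV; apply: ler_pM => //.
  - exact: cnorm_ge0.
  - by rewrite invr_ge0 cnorm_ge0.
  - apply: dP; apply: le_lt_trans (csquare_dist (_ : csquare z rj u)) _.
      by case: ur.
    by rewrite /rj mulrA.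
  - by rewrite lef_pV2 // posrE //; exact: lt_le_trans ru.
have h4 := winding_sum_ge z (p3 n0) r30.
have h5 := ler_wpM2l (cnorm_ge0 (h z)) h4; rewrite -cnormM in h5.
move: h1 h2 h3 h5.
move: (boundary_sum F _ _ _) (boundary_sum F _ _ _) => S T.
set W := h z * _ => h1 h2 h3 h5.
have := cnorm_triangle W S 0; rewrite !subr0 (cnormBC W).
have := cnorm_triangle S T 0; rewrite !subr0 (cnormBC S).
have : 9 * eta = N (h z) - 2 * M by rewrite /eta; field.
lra.
Qed.

(** * Consequences of the maximum principle in one variable *)

Lemma cdiffD F G z : cdiff F z -> cdiff G z -> cdiff (fun w => F w + G w) z.
Proof.
move=> [l lP] [m mP]; exists (l + m) => e e0.
have e2 : 0 < e / 2 by lra.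
have [d1 d10 F1] := lP _ e2; have [d2 d20 G1] := mP _ e2.
exists (Num.min d1 d2) => [|w]; first by rewrite lt_min d10.
rewrite lt_min => /andP[/F1 f1 /G1 g1].
have -> : F w + G w - (F z + G z) - (l + m) * (w - z) =
  (F w - F z - l * (w - z)) + (G w - G z - m * (w - z)) by ring.
apply: le_trans (cnormD _ _) _; lra.
Qed.

Lemma cdiff_difference_quotient F (c : R[i]) z u : u <> z -> cdiff F u ->
  cdiff (fun w => (F w - F z) / (w - z)) u.
Proof.
move=> uz Fu; apply: cdiffM; last exact: cdiff_inv_sub.
by apply: cdiffD => //; exact: cdiff_cst.
Qed.

(** A Schwarz lemma with a crude constant: the maximum principle for the
    difference quotient at the origin, whose singularity there is the
    exceptional point. *)
Lemma schwarz_estimate F (r M : R) a : 0 < r ->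
  (forall u, csquare 0 r u -> cdiff F u) ->
  (forall u, csquare 0 r u -> N (F u - F 0) <= M) ->
  N a <= r / 4 -> N (F a - F 0) <= 8 * M / r * N a.
Proof.
move=> r0 Fd FM ar.
have [->|/eqP a0] := eqVneq a 0; first by rewrite subrr cnorm0 mulr0.
have rr0 : csquare 0 r 0.
  by apply: csquare_cnorm; rewrite subrr cnorm0 ltW.
have [l lP] := Fd _ rr0.
pose q u := if u == 0 then l else (F u - F 0) / (u - 0).
have sub u : csquare a (r / 2) u -> csquare 0 r u.
  move=> /csquareP[h1 h2]; have := abs_Re_le_cnorm a; have := abs_Im_le_cnorm a.
  rewrite !ler_norml in h1 h2 * => /andP[? ?] /andP[? ?].
  by apply/csquareP; rewrite /= !ler_norml; split; lra.
have qd u : u <> 0 -> csquare a (r / 2) u -> cdiff q u.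
  move=> u0 /sub/Fd Fu; have Nu : 0 < N u by rewrite cnorm_gt0; apply/eqP.
  apply: (@cdiff_near (fun w => (F w - F 0) / (w - 0)) _ _ (N u)) => // [w uw|].
    rewrite /q; case: eqP => // w0; move: uw; rewrite w0 sub0r cnormN.
    by rewrite ltxx.
  exact: (@cdiff_difference_quotient F 0).
have qc u : csquare a (r / 2) u -> ccont q u.
  move=> ur; have [->|/eqP u0] := eqVneq u 0; last first.
    by apply: cdiff_ccont; exact: qd.
  move=> e e0; have [d d0 dP] := lP _ e0; exists d => // w wd.
  rewrite /q eqxx; case: eqP => [_|/eqP w0].
    by rewrite subrr cnorm0 ltW.
  have Nw : 0 < N (w - 0) by rewrite subr0 cnorm_gt0.
  rewrite -(ler_pM2r Nw) -cnormM; apply: le_trans (dP _ wd).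
  rewrite (_ : ((F w - F 0) / (w - 0) - l) * (w - 0) = F w - F 0 - l * (w - 0)) //.
  by rewrite !subr0; field.
have r2 : 0 < r / 2 by lra.
have := @center_value_le q 0 a (r / 2) (4 * M / r) r2 qc _ _.
move=> /(_ (fun u ur u0 => qd u u0 ur)) h.
have {h} : N (q a) <= 2 * (4 * M / r).
  apply: h => u ur ua.
  have ur4 : r / 4 <= N u by have := cnormB u a; lra.
  rewrite /q; case: eqP => [u0|/eqP u0].
    by move: ur4; rewrite u0 cnorm0; lra.
  rewrite subr0 cnorm_div -mulrA mulrCA; apply: ler_pM.
  - exact: cnorm_ge0.
  - by rewrite invr_ge0 cnorm_ge0.
  - exact: FM (sub _ ur).
  have -> : 4 / r = (r / 4)^-1 by field; rewrite gt_eqF.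
  by rewrite lef_pV2 // posrE ?cnorm_gt0 //; lra.
have Na : 0 < N a by rewrite cnorm_gt0; apply/eqP.
rewrite /q (introF eqP a0) subr0 cnorm_div ler_pdivrMr //; lra.
Qed.

(** In [w ^ (2 n) - 1 = (w ^ n - 1) (w ^ n + 1)] the last factor is at least
    [3 / 2], so that the distance from [1] would grow without bound under
    repeated squaring. *)
Lemma eq1_of_powers w : (forall n, N (w ^+ n - 1) <= 1 / 2) -> w = 1.
Proof.
move=> w1; apply/eqP; rewrite -subr_eq0 -cnorm_eq0; apply/negP => /negP c0.
set c := N (w - 1) in c0; have {}c0 : 0 < c by rewrite lt_def c0 cnorm_ge0.
have grow k : (1 + k%:R / 2) * c <= N (w ^+ (2 ^ k) - 1).
  elim: k => [|k IH]; first by rewrite mul0r addr0 mul1r expn0 expr1.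
  rewrite expnS mulnC exprM.
  have -> : w ^+ (2 ^ k) ^+ 2 - 1 = (w ^+ (2 ^ k) - 1) * (w ^+ (2 ^ k) + 1).
    by ring.
  rewrite cnormM -natr1.
  have h : 3 / 2 <= N (w ^+ (2 ^ k) + 1).
    have := cnorm_lowerD 2 (w ^+ (2 ^ k) - 1).
    rewrite (_ : 2 + (w ^+ (2 ^ k) - 1) = w ^+ (2 ^ k) + 1); last by ring.
    rewrite cnorm_nat; have := w1 (2 ^ k)%N; lra.
  have kp : 0 <= k%:R * c by rewrite mulr_ge0 ?ler0n // ltW.
  have c1 : 0 <= (1 + k%:R / 2) * c by rewrite mulrDl mul1r; lra.
  have c2 : 0 <= 3 / 2 :> R by lra.
  have := ler_pM c1 c2 IH h; lra.
have hn := archi_boundP (divr_ge0 ler01 (ltW c0)).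
set n := Num.Def.archi_bound _ in hn.
have := le_trans (grow n) (w1 _).
rewrite ltr_pdivrMr // in hn; lra.
Qed.

(** The local strong maximum principle: if [F 0 = 1 = max |F|], the powers of
    [F] satisfy the Schwarz estimate uniformly, so that all powers of [F a]
    stay close to [1]. *)
Lemma local_strong_maximum F (r : R) a : 0 < r ->
  (forall u, csquare 0 r u -> cdiff F u) ->
  (forall u, csquare 0 r u -> N (F u) <= 1) -> F 0 = 1 ->
  N a <= r / 32 -> F a = 1.
Proof.
move=> r0 Fd F1 F0 ar; apply: eq1_of_powers => n.
have -> : 1 = F 0 ^+ n by rewrite F0 expr1n.
apply: le_trans (schwarz_estimate (M := 2) (F := fun u => F u ^+ n) r0 _ _ _) _.
- by move=> u /Fd; exact: cdiffX.
- move=> u /F1 u1; apply: le_trans (cnormB _ _) _; rewrite F0 expr1n cnorm1.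
  have : N (F u ^+ n) <= 1 by rewrite cnormX exprn_ile1 // cnorm_ge0.
  lra.
- lra.
have -> : 8 * 2 / r * N a = 16 * N a / r by ring.
by rewrite ler_pdivrMr //; lra.
Qed.

Lemma bounded_on_square F w0 s0 : 0 < s0 ->
  (forall z, in_square w0 s0 z -> ccont F z) ->
  exists M : R, forall z, in_square w0 s0 z -> N (F z) <= M.
Proof.
move=> s00 Fc.
pose P w s := exists M : R, forall z, in_square w s z -> N (F z) <= M.
apply: (@square_subdivision_ind P) => // [w s s_gt0 Psub|z zw]; last first.
  have [d d0 dP] := Fc _ zw _ ltr01.
  exists (d / 2) => [|w' s' s0' sd zw']; first lra.
  exists (N (F z) + 1) => u uw'.
  have := in_square_dist zw' uw' => uz.
  have /dP : N (u - z) < d by lra.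
  have := cnormD (F u - F z) (F z); rewrite subrK; lra.
have /choice[M MP] : forall ab : 'I_3 * 'I_3, exists M : R, forall z,
    in_square (subcorner w s ab.1 ab.2) (s / 3) z -> N (F z) <= M.
  by move=> [a b]; exact: Psub.
exists (\sum_ab `|M ab|) => z [h1 h2 h3 h4].
have third (x y : R) : x <= y -> y <= x + s ->
    exists a : 'I_3, x + a%:R * (s / 3) <= y <= x + a%:R * (s / 3) + s / 3.
  move=> xy yx; have [y1|y1] := leP y (x + s / 3).
    by exists ord0 => /=; apply/andP; split; lra.
  have [y2|y2] := leP y (x + 2 * (s / 3)).
    by exists (inord 1); rewrite inordK //; apply/andP; split; lra.
  by exists (inord 2); rewrite inordK //; apply/andP; split; lra.
have [a /andP[a1 a2]] := third _ _ h1 h2.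
have [b /andP[b1 b2]] := third _ _ h3 h4.
have : N (F z) <= M (a, b).
  by apply: MP; split; rewrite ?Re_subcorner ?Im_subcorner.
move=> /le_trans; apply; apply: le_trans (ler_norm _) _.
by rewrite (bigD1 (a, b)) //= lerDl sumr_ge0.
Qed.

(** Since [F] vanishes near [0], the maximum principle applies to
    [F u / u ^ n] for every [n].  On the boundary of the square of half-side [3]
    around [1] the denominator is at least [2 ^ n], while it is [1] at [1]. *)
Lemma identity_on_line F (d : R) : 0 < d ->
  (forall u, csquare 1 3 u -> cdiff F u) ->
  (forall u, N u < d -> F u = 0) -> F 1 = 0.
Proof.
move=> d0 Fd F0.
have [M MP] : exists M : R, forall z, csquare 1 3 z -> N (F z) <= M.
  by apply: bounded_on_square => [|z /Fd]; [lra|exact: cdiff_ccont].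
have hd n u : csquare 1 3 u -> cdiff (fun u => F u * (u - 0)^-1 ^+ n) u.
  move=> ur; have [->|/eqP u0] := eqVneq u 0.
    apply: (@cdiff_near (fun=> 0) _ _ d) => //; last exact: cdiff_cst.
    by move=> w; rewrite subr0 => /F0 ->; rewrite mul0r.
  apply: cdiffM; first exact: Fd.
  by apply: cdiffX; exact: cdiff_inv_sub.
have three : 0 < 3 :> R by lra.
have M0 : 0 <= M.
  apply: le_trans (MP 1 _); first exact: cnorm_ge0.
  by apply: csquare_cnorm; rewrite subrr cnorm0; lra.
have bound n : N (F 1) <= 2 * (M / 2 ^+ n).
  have := @center_value_le _ 0 1 3 (M / 2 ^+ n) three
    (fun u ur => cdiff_ccont (hd n u ur)) (fun u ur _ => hd n u ur) _.
  rewrite subr0 invr1 expr1n mulr1; apply => u ur u3.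
  rewrite subr0 cnormM cnormX cnormV -exprVn; apply: ler_pM.
  - exact: cnorm_ge0.
  - by rewrite exprn_ge0 // invr_ge0 cnorm_ge0.
  - exact: MP.
  have u2 : 2 <= N u by have := cnormB u 1; rewrite cnorm1; lra.
  have u0 : 0 < N u by lra.
  rewrite lerXn2r ?nnegrE ?invr_ge0 ?(ltW u0) //.
  by rewrite lef_pV2 // posrE.
apply/eqP; rewrite -cnorm_eq0; apply/negP => /negP c0.
have {}c0 : 0 < N (F 1) by rewrite lt_def c0 cnorm_ge0.
have [n nP] := @exists_small_power (2 * M) _ c0.
have := bound n.*2; rewrite -mul2n exprM => h.
have : 2 * (M / 2 ^+ 2 ^+ n) <= 2 * M / 3 ^+ n.
  rewrite mulrA ler_wpM2l ?mulr_ge0 // lef_pV2 ?posrE ?exprn_gt0 //.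
  by rewrite lerXn2r ?nnegrE //; rewrite ?exprn_ge0 // expr2; lra.
lra.
Qed.

End boundary_sums.

(** * Complex normed spaces and restriction to lines *)

Section real_norm.
Variable R : realType.

Definition rnorm (V : normedModType R[i]) (v : V) : R := Re `|v|.

Lemma rnormE (V : normedModType R[i]) (v : V) : `|v| = (rnorm v)%:C.
Proof.
rewrite /rnorm; have /ger0_Im : 0 <= `|v| by exact: normr_ge0.
by case: `|v| => x y /= ->.
Qed.

Lemma rnorm_cnorm (z : R[i]) : rnorm z = N z.
Proof. by case: z => x y; rewrite /rnorm normc_def. Qed.

Lemma rnorm_ge0 (V : normedModType R[i]) (v : V) : 0 <= rnorm v.
Proof. by rewrite -lecR -rnormE; exact: normr_ge0. Qed.

Lemma rnormD (V : normedModType R[i]) (u v : V) :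
  rnorm (u + v) <= rnorm u + rnorm v.
Proof. by rewrite -lecR rmorphD /= -!rnormE ler_normD. Qed.

Lemma rnormBC (V : normedModType R[i]) (u v : V) : rnorm (u - v) = rnorm (v - u).
Proof. by rewrite /rnorm distrC. Qed.

Lemma rnormZ (V : normedModType R[i]) (c : R[i]) (v : V) :
  rnorm (c *: v) = N c * rnorm v.
Proof.
apply: complexI; rewrite -rnormE normrZ rmorphM /= -rnormE.
by rewrite -rnorm_cnorm -rnormE.
Qed.

Lemma rnorm0 (V : normedModType R[i]) : rnorm (0 : V) = 0.
Proof. by apply: complexI; rewrite -rnormE normr0. Qed.

Lemma rnorm_eq0 (V : normedModType R[i]) (v : V) : rnorm v = 0 -> v = 0.
Proof. by move=> v0; apply/eqP; rewrite -normr_eq0 rnormE v0. Qed.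

Lemma nbhs_rnormP (V : normedModType R[i]) (x : V) (A : set V) :
  nbhs x A <-> exists2 d : R, 0 < d & forall y, rnorm (y - x) < d -> A y.
Proof.
split=> [/nbhs_normP[e /= e0 eA]|[d d0 dA]].
  have [d ed] : exists d : R, e = d%:C.
    by exists (Re e); case: e e0 {eA} => a b; rewrite ltcE /= => /andP[/eqP ->].
  rewrite ed ltcR in e0; exists d => // y yx; apply: eA => /=.
  by rewrite ed distrC rnormE ltcR.
apply/nbhs_normP; exists d%:C => /=; first by rewrite ltcR.
by move=> y; rewrite /= distrC rnormE ltcR; exact: dA.
Qed.

Lemma coord_le_rnorm n (v : 'rV[R[i]]_n) j : N (v ord0 j) <= rnorm v.
Proof.
rewrite -lecR -rnormE -rnorm_cnorm -rnormE [`|v|](mx_normE v).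
rewrite -[leLHS]nngE num_le.
exact: (@le_bigmax _ _ _ _ (fun i : 'I_1 * 'I_n => `|v i.1 i.2|%:nng)
  (ord0, j)).
Qed.

Lemma rnorm_le n (v : 'rV[R[i]]_n) (e : R) : 0 <= e ->
  (forall j, N (v ord0 j) <= e) -> rnorm v <= e.
Proof.
move=> e0 ve; rewrite -lecR -rnormE [`|v|](mx_normE v).
have ec : 0 <= e%:C :> R[i] by rewrite lecR.
rewrite -[e%:C]/((NngNum ec)%:num) num_le; apply/bigmax_leP; split.
  by rewrite -num_le.
move=> [i j] _; rewrite -num_le /= ord1.
by rewrite rnormE lecR rnorm_cnorm.
Qed.

Lemma differentiable_rnorm (V W : normedModType R[i]) (F : V -> W) x :
  differentiable F x -> forall e : R, 0 < e -> exists2 d : R, 0 < d &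
    forall h, rnorm h < d ->
      rnorm (F (x + h) - F x - 'd F x h) <= e * rnorm h.
Proof.
move=> /diff_locally /eqaddoP h e e0.
have /h/nbhs_rnormP[d d0 dP] : 0 < e%:C :> R[i] by rewrite ltcR.
exists d => // v vd; rewrite -lecR rmorphM /= -!rnormE.
have := dP v; rewrite subr0 => /(_ vd).
rewrite -[(_ - _) v]/(F (v + x) - (F x + 'd F x v)) opprD addrA.
by rewrite [v + x]addrC.
Qed.

Lemma differentiable_lipschitz_at (V W : normedModType R[i]) (F : V -> W) x :
  differentiable F x -> exists2 C : R, 0 < C & exists2 d : R, 0 < d &
    forall y, rnorm (y - x) < d -> rnorm (F y - F x) <= C * rnorm (y - x).
Proof.
move=> Fx; have [d d0 dP] := differentiable_rnorm Fx ltr01.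
have /nbhs_rnormP[d' d'0 d'P] : \forall h \near (0 : V), rnorm ('d F x h) < 1.
  have c0 : {for 0, continuous ('d F x)} by exact: diff_continuous.
  have /c0 : nbhs ('d F x 0) [set w : W | rnorm w < 1].
    by rewrite linear0; apply/nbhs_rnormP; exists 1 => // y; rewrite subr0.
  by [].
have L v : rnorm ('d F x v) <= 2 / d' * rnorm v.
  have [v0|v0] := eqVneq (rnorm v) 0.
    by rewrite (rnorm_eq0 v0) linear0 !rnorm0 mulr0.
  have {}v0 : 0 < rnorm v by rewrite lt_def v0 rnorm_ge0.
  have t0 : 0 < d' / 2 / rnorm v by rewrite !divr_gt0.
  have Nt : N (d' / 2 / rnorm v)%:C = d' / 2 / rnorm v.
    by rewrite cnorm_real gtr0_norm.
  have := d'P ((d' / 2 / rnorm v)%:C *: v).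
  rewrite subr0 linearZ !rnormZ Nt divfK ?gt_eqF // => /(_ (ltac:(lra))).
  rewrite mulrAC -ltr_pdivlMr ?invr_gt0 // invrK mul1r => /ltW.
  by rewrite -ler_pdivlMl ?divr_gt0 // invf_div.
exists (1 + 2 / d'); first by rewrite addr_gt0 // divr_gt0.
exists d => // y yx; have := dP _ yx; rewrite [x + _]addrC subrK => h.
have := rnormD (F y - F x - 'd F x (y - x)) ('d F x (y - x)).
by rewrite subrK; have := L (y - x); lra.
Qed.

Lemma cdiff_along_line n (F : 'rV[R[i]]_n -> R[i]) b v t :
  differentiable F (b + t *: v) -> cdiff (fun s => F (b + s *: v)) t.
Proof.
move=> Fd; exists ('d F (b + t *: v) v) => e e0.
have v1 : 0 < rnorm v + 1 by have := rnorm_ge0 v; lra.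
have [d d0 dP] := differentiable_rnorm Fd (divr_gt0 e0 v1).
exists (d / (rnorm v + 1)) => [|w wt]; first exact: divr_gt0.
have wv : N (w - t) * rnorm v <= N (w - t) * (rnorm v + 1).
  by rewrite ler_wpM2l ?cnorm_ge0 //; lra.
have hd : rnorm ((w - t) *: v) < d.
  by rewrite rnormZ; rewrite ltr_pdivlMr // in wt; exact: le_lt_trans wv wt.
have := dP _ hd; rewrite linearZ -rnorm_cnorm.
rewrite (_ : b + t *: v + (w - t) *: v = b + w *: v); last first.
  by rewrite -addrA -scalerDl [t + _]addrC subrK.
rewrite [_ * (w - t)]mulrC => h; apply: le_trans h _.
by rewrite rnormZ mulrAC ler_pdivrMr // -mulrA ler_wpM2l ?(ltW e0).
Qed.

End real_norm.

(** * Charts, identity theorem and maximum principle on manifolds *)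

Section manifold.
Variables (R : realType) (X : complex_space R) (dimX : nat).
Hypothesis manX : complex_manifold dimX X.
Implicit Types (c d : chart R X) (p q : X).

Lemma chart_continuous c p (e : R) : atlas c -> chart_dom c p -> 0 < e ->
  \forall q \near p, chart_dom c q /\ rnorm (c q - c p) < e.
Proof.
move=> /atlas_chart[cop cc _ _ _] cp e0; near=> q; split; near: q.
  exact: open_nbhs_nbhs.
have cpe : nbhs (c p) [set z | rnorm (z - c p) < e].
  by apply/nbhs_rnormP; exists e.
exact: (cc p cp _ cpe).
Unshelve. all: by end_near. Qed.

Lemma chart_nbhs c p (A : set X) : atlas c -> chart_dom c p -> nbhs p A ->
  exists2 e : R, 0 < e &
    forall q, chart_dom c q -> rnorm (c q - c p) < e -> A q.
Proof.
move=> /atlas_chart[cop cc cinj cim _] cp /nbhs_interior pA.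
have [W Wop cW] := cim (A^° `&` chart_dom c)
  (openI (@open_interior _ _) cop) (@subIsetr _ _ _).
have : W (c p).
  have : (c @` (A^° `&` chart_dom c)) (c p).
    by exists p => //; split => //; exact: nbhs_singleton.
  by rewrite cW => -[].
move=> Wp; have /nbhs_rnormP[e e0 eW] := open_nbhs_nbhs (conj Wop Wp).
exists e => // q cq /eW Wq.
have : (c @` (A^° `&` chart_dom c)) (c q) by rewrite cW; split => //; exists q.
move=> [q' [Aq' cq'] /(cinj _ _ (mem_set cq') (mem_set cq)) <-].
exact: interior_subset.
Qed.

Lemma chart_surj c p : atlas c -> chart_dom c p ->
  exists2 e : R, 0 < e &
    forall z, rnorm (z - c p) < e -> exists2 q, chart_dom c q & c q = z.
Proof.
move=> ac cp; have [_ cop] := manX ac.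
have : nbhs (c p) (c @` chart_dom c).
  by apply: open_nbhs_nbhs; split => //; exists p.
by move=> /nbhs_rnormP[e e0 eP]; exists e => // z /eP[q ? ?]; exists q.
Qed.

Definition chart_ball c p (A : set X) (e : R) := [/\ 0 < e,
  (forall q, chart_dom c q -> rnorm (c q - c p) < e -> A q) &
  (forall z, rnorm (z - c p) < e -> exists2 q, chart_dom c q & c q = z)].

Lemma chart_ball_ex c p (A : set X) : atlas c -> chart_dom c p -> nbhs p A ->
  exists e, chart_ball c p A e.
Proof.
move=> ac cp /(chart_nbhs ac cp)[e e0 eA]; have [f f0 fP] := chart_surj ac cp.
exists (Num.min e f); split; first by rewrite lt_min e0.
  by move=> q cq; rewrite lt_min => /andP[/eA h _]; exact: h.
by move=> z; rewrite lt_min => /andP[_ /fP].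
Qed.

(* [p] is the default value outside the image of the chart. *)
Definition chart_inv c p z : X := xget p [set q | chart_dom c q /\ c q = z].
Arguments chart_inv : clear implicits.

Lemma chart_invK c p z : (exists2 q, chart_dom c q & c q = z) ->
  chart_dom c (chart_inv c p z) /\ c (chart_inv c p z) = z.
Proof. move=> [q cq qz].
exact: (@xgetPex _ p [set q | chart_dom c q /\ c q = z] (ex_intro _ q _)). Qed.

Lemma chartK c p q : atlas c -> chart_dom c q -> chart_inv c p (c q) = q.
Proof.
move=> /atlas_chart[_ _ cinj _ _] cq.
have [|c1 c2] := @chart_invK c p (c q); first by exists q.
exact: (cinj _ _ (mem_set c1) (mem_set cq) c2).
Qed.

Lemma chart_inv_near c p q (A : set X) : atlas c -> chart_dom c q -> nbhs q A ->
  exists2 e : R, 0 < e & forall z, rnorm (z - c q) < e ->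
    [/\ A (chart_inv c p z), chart_dom c (chart_inv c p z)
      & c (chart_inv c p z) = z].
Proof.
move=> ac cq /(chart_ball_ex ac cq)[e [e0 eA eP]]; exists e => // z ze.
have [c1 c2] := chart_invK p (eP _ ze); split => //.
by apply: eA => //; rewrite c2.
Qed.

Lemma cdiff_chart_line c p (A : set X) (u : X -> R[i]) e b v t :
  atlas c -> chart_ball c p A e -> (forall q, A q -> fun_holomorphic_at u q) ->
  rnorm (b + t *: v - c p) < e ->
  cdiff (fun s => u (chart_inv c p (b + s *: v))) t.
Proof.
move=> ac [e0 eA eP] uA te; set z := b + t *: v.
have [cq qz] := chart_invK p (eP _ te); rewrite -/z in cq qz.
have [F [Fhol uF]] : exists F : 'rV[R[i]]_(chart_dim c) -> R[i],
    germ_holomorphic F (c (chart_inv c p z)) /\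
    \forall q \near chart_inv c p z, u q = F (c q).
  by apply: uA => //; apply: eA => //; rewrite qz.
have [f f0 fP] := chart_inv_near p ac cq uF.
have v1 : 0 < rnorm v + 1 by have := rnorm_ge0 v; lra.
apply: (@cdiff_near _ (fun s => F (b + s *: v)) _ _ (f / (rnorm v + 1))).
- exact: divr_gt0.
- move=> w; rewrite ltr_pdivlMr // => wf.
  have wz : rnorm (b + w *: v - c (chart_inv c p z)) < f.
    rewrite qz /z opprD addrACA subrr add0r -scalerBl rnormZ.
    apply: le_lt_trans wf; rewrite ler_wpM2l ?cnorm_ge0 //; lra.
  by have [-> _ ->] := fP _ wz.
apply: cdiff_along_line; move: Fhol; rewrite qz; exact: nbhs_singleton.
Qed.

(** Two points of a small coordinate ball lie on a complex line which stays in
    a much larger ball along the square used in [identity_on_line]; hence one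
    neighbourhood serves all functions holomorphic on [A]. *)
Lemma identity_near p (A : set X) : nbhs p A -> exists2 V : set X, nbhs p V &
  V `<=` A /\ forall (u : X -> R[i]) (k : R[i]),
  (forall q, A q -> fun_holomorphic_at u q) ->
  forall y, V y -> (\forall q \near y, u q = k) -> forall z, V z -> u z = k.
Proof.
move=> pA; have [c ac cp] := atlas_cover p.
have [e ball_e] := chart_ball_ex ac cp pA; have [e0 eA eP] := ball_e.
have e16 : 0 < e / 16 by lra.
exists [set q | chart_dom c q /\ rnorm (c q - c p) < e / 16].
  exact: chart_continuous.
split=> [q [cq qe]|u k uA y [cy ye] yk z [cz ze]].
  by apply: eA => //; lra.
set v := c z - c y; have ve : rnorm v < e / 8.
  have := rnormD (c z - c p) (c p - c y).
  by rewrite addrA subrK (rnormBC (c p)); rewrite /v; lra.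
have [f f0 fP] := chart_inv_near p ac cy yk.
have v1 : 0 < rnorm v + 1 by have := rnorm_ge0 v; lra.
pose F t := u (chart_inv c p (c y + t *: v)) - k.
suff : F 1 = 0.
  rewrite /F scale1r /v [c y + _]addrC subrK chartK // => /eqP.
  by rewrite subr_eq0 => /eqP.
apply: (@identity_on_line _ F (f / (rnorm v + 1))) => [||t].
- exact: divr_gt0.
- move=> t t3; apply: cdiffD; last exact: cdiff_cst.
  apply: (cdiff_chart_line ac ball_e uA).
  have t7 : N t <= 7.
    have := csquare_dist t3; have := cnormD (t - 1) 1.
    by rewrite subrK cnorm1; lra.
  have := rnormD (c y - c p) (t *: v); rewrite rnormZ addrAC.
  have : N t * rnorm v <= 7 * rnorm v by rewrite ler_wpM2r ?rnorm_ge0.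
  lra.
rewrite ltr_pdivlMr // => tf; rewrite /F.
have [|-> _ _] := fP (c y + t *: v); last by rewrite subrr.
rewrite addrAC subrr add0r rnormZ; apply: le_lt_trans tf.
by rewrite ler_wpM2l ?cnorm_ge0 //; lra.
Qed.

(** The strong maximum principle on complex lines through [p], for the function
    normalised to be [1] at [p]. *)
Lemma maximum_near (u : X -> R[i]) p : holomorphic_fun u ->
  (forall q, N (u q) <= N (u p)) -> \forall q \near p, u q = u p.
Proof.
move=> uh umax; have [up0|up0] := eqVneq (u p) 0.
  apply: nearW => q; apply/eqP; rewrite up0 -cnorm_eq0 eq_le cnorm_ge0 andbT.
  by rewrite (le_trans (umax q)) // up0 cnorm0.
have [c ac cp] := atlas_cover p.
have [e ball_e] := chart_ball_ex ac cp (filterT : nbhs p setT).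
have [e0 _ eP] := ball_e.
have : \forall q \near p, chart_dom c q /\ rnorm (c q - c p) < e / 65.
  by apply: chart_continuous => //; lra.
apply: filterS => q [cq qe]; set v := c q - c p in qe.
pose F t := u (chart_inv c p (c p + t *: v)) / u p.
suff : F 1 = 1.
  rewrite /F scale1r /v [c p + _]addrC subrK chartK //.
  move=> /(congr1 (fun w => w * u p)).
  by rewrite divfK // mul1r.
apply: (@local_strong_maximum _ F 32) => //.
- move=> t t32; apply: cdiffM; last exact: cdiff_cst.
  apply: (cdiff_chart_line ac ball_e) => //.
  rewrite addrAC subrr add0r rnormZ.
  have := csquare_dist t32; rewrite subr0 => t64.
  have : N t * rnorm v <= 64 * rnorm v by rewrite ler_wpM2r ?rnorm_ge0 //; lra.
  lra.
- move=> t _; rewrite /F cnorm_div ler_pdivrMr ?cnorm_gt0 // mul1r; exact: umax.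
- by rewrite /F scale0r addr0 chartK // divff.
- by rewrite cnorm1; lra.
Qed.

(** * A Stein manifold of positive dimension is not compact *)

Lemma fun_holomorphic_at_continuous (u : X -> R[i]) p :
  fun_holomorphic_at u p -> {for p, continuous u}.
Proof.
move=> uh; have [c ac cp] := atlas_cover p.
have [F [Fh uF]] := uh c ac cp; have [_ cc _ _ _] := atlas_chart ac.
have up := nbhs_singleton uF.
have Fc : {for c p, continuous F}.
  by apply: differentiable_continuous; exact: nbhs_singleton Fh.
have : (F \o c) x @[x --> p] --> u p.
  by rewrite up; exact: continuous_comp (cc p cp) Fc.
apply: cvg_trans; apply: near_eq_cvg; exact: filterS uF.
Qed.

Lemma cnorm_continuous (u : X -> R[i]) p : {for p, continuous u} ->
  {for p, continuous (fun q => N (u q))}.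
Proof.
move=> uc; apply/cvgrPdist_lt => e e0.
have upe : nbhs (u p) [set z | rnorm (z - u p) < e].
  by apply/nbhs_rnormP; exists e.
have : \forall q \near p, rnorm (u q - u p) < e by exact: uc _ upe.
apply: filterS => q; rewrite rnorm_cnorm.
apply: le_lt_trans; rewrite distrC ler_norml.
have := cnormD (u q - u p) (u p); have := cnormD (u p - u q) (u q).
by rewrite !subrK (cnormBC (u p)) => *; apply/andP; split; lra.
Qed.

Lemma connected_clopen_set (A : set X) :
  connected [set: X] -> (forall p, A p -> \forall q \near p, A q) ->
  (forall p, ~ A p -> \forall q \near p, ~ A q) ->
  A !=set0 -> forall p, A p.
Proof.
move=> conX Ao Ac A0 p.
have AT : A = setT.
  apply: conX => //.
  - by exists A; rewrite ?setTI // openE => q /Ao.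
  - exists A; rewrite ?setTI // -[X in closed X]setCK; apply: open_closedC.
    by rewrite openE => q /Ac.
by rewrite AT.
Qed.

(** On a compact manifold the modulus of a holomorphic function has a maximum,
    and by connectedness the function takes this value everywhere; so points
    cannot be separated. *)
Lemma stein_not_compact : (0 < dimX)%N -> [set: X] !=set0 ->
  connected [set: X] -> stein X -> ~ compact [set: X].
Proof.
move=> n0 [p _] conX [_ sep] cptX.
have [c ac cp] := atlas_cover p.
have [e [e0 _ eP]] := chart_ball_ex ac cp (filterT : nbhs p setT).
have [dimc _] := manX ac.
have [q qp] : exists q, p <> q.
  have j : 'I_(chart_dim c) by rewrite dimc; exact: (Ordinal n0).
  have Ne : N (e / 2)%:C = e / 2 by rewrite cnorm_real gtr0_norm //; lra.
  have [|q cq qz] := eP (c p + const_mx (e / 2)%:C).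
    rewrite addrAC subrr add0r; apply: (@le_lt_trans _ _ (e / 2)); last lra.
    by apply: rnorm_le => [|k]; [lra|rewrite mxE Ne].
  exists q => pq; move: qz; rewrite -pq => /matrixP/(_ ord0 j).
  rewrite !mxE -{1}[c p ord0 j]addr0 => /addrI /esym /eqP.
  by rewrite -cnorm_eq0 Ne gt_eqF //; lra.
have [u uh upq] := sep p q qp.
have uc x : {for x, continuous u} by exact: fun_holomorphic_at_continuous.
have [||m _ mP] := @compact_EVT_max X R (fun q => N (u q)) setT _ cptX.
- by exists p.
- by apply: continuous_subspaceT => x; exact: cnorm_continuous.
have const x : u x = u m.
  apply: (connected_clopen_set (A := [set y | u y = u m])); last by exists m.
  - exact: conX.
  - move=> y ym; have := @maximum_near u y uh; rewrite ym; apply=> z.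
    by apply: mP; rewrite inE.
  move=> y ym.
  have Nd : 0 < N (u y - u m) by rewrite cnorm_gt0 subr_eq0; apply/eqP.
  have yn : nbhs (u y) [set z | rnorm (z - u y) < N (u y - u m)].
    by apply/nbhs_rnormP; exists (N (u y - u m)).
  have : \forall z \near y, rnorm (u z - u y) < N (u y - u m).
    exact: uc y _ yn.
  apply: filterS => z; rewrite rnorm_cnorm => zy zm.
  by move: zy; rewrite zm cnormBC ltxx.
by apply: upq; rewrite !const.
Qed.

(** * Coordinate polydiscs *)

Lemma compact_csquare (z : R[i]) (r : R) : compact (csquare z r).
Proof.
pose f (xy : R * R) : R[i] := xy.1 +i* xy.2.
have -> : csquare z r = f @` (`[Re z - r, Re z + r]%classic `*`
    `[Im z - r, Im z + r]%classic).
  apply/seteqP; split=> [u /csquareP[h1 h2]|_ [[x y] [/= h1 h2] <-]].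
    exists (Re u, Im u); last by case: u {h1 h2}.
    by rewrite /= !in_itv /= !ler_norml in h1 h2 *; split; lra.
  apply/csquareP; rewrite /= !ler_norml; rewrite !in_itv /= in h1 h2.
  by split; lra.
apply: continuous_compact; last by apply: compact_setX; exact: segment_compact.
apply: continuous_subspaceT => -[x y] A /nbhs_rnormP[d d0 dA].
have d2 : 0 < d / 2 by lra.
exists (ball x (d / 2), ball y (d / 2)); first by split; exact: nbhsx_ballx.
move=> [x' y'] /= [bx by']; apply: dA; rewrite rnorm_cnorm.
apply: le_lt_trans (cnorm_le_ReIm _) _.
by rewrite /ball /= in bx by'; rewrite /f /= !(distrC _ x) !(distrC _ y); lra.
Qed.

Lemma chart_inv_continuous c p q : atlas c -> chart_dom c q ->
  {for c q, continuous (chart_inv c p)}.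
Proof.
move=> ac cq A; rewrite chartK // => Aq.
have [e e0 eP] := chart_inv_near p ac cq Aq.
by apply/nbhs_rnormP; exists e => // z /eP[].
Qed.

(** Closed polydiscs in a chart are compact, hence closed in the whole space. *)
Lemma closed_polysquare c p (A : set X) (e r : R) : atlas c ->
  chart_ball c p A e -> 0 < r -> 2 * r < e -> exists C : set X,
  [/\ closed C, C `<=` chart_dom c &
    forall q, chart_dom c q -> (C q <-> forall j, csquare (c p ord0 j) r (c q ord0 j))].
Proof.
move=> ac [e0 eA eP] r0 re.
pose P := [set z : 'rV[R[i]]_(chart_dim c) |
  forall j, csquare (c p ord0 j) r (z ord0 j)].
have cptP : compact P.
  exact: (@rV_compact _ _ (fun j => csquare (c p ord0 j) r)
    (fun j => @compact_csquare _ _)).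
have Pc z : P z -> exists2 q, chart_dom c q & c q = z.
  move=> Pz; apply: eP; apply: le_lt_trans re; apply: rnorm_le => [|j].
    by rewrite mulr_ge0 // ltW.
  by rewrite !mxE; exact: csquare_dist.
exists (chart_inv c p @` P); split.
- apply: compact_closed; first exact: space_hausdorff.
  apply: continuous_compact => //; apply: continuous_in_subspaceT => z.
  by rewrite inE => /Pc[q cq <-]; exact: chart_inv_continuous.
- by move=> _ [z /Pc/(chart_invK p)[? _] <-].
- move=> q cq; split=> [[z Pz <-]|Pq].
    by have [_ ->] := chart_invK p (Pc _ Pz).
  by exists (c q) => //; rewrite chartK.
Qed.

(** * Modification of continuous maps near a point *)

Lemma real_complex_continuous (T : topologicalType) (g : T -> R) x :
  {for x, continuous g} -> {for x, continuous (fun t => (g t)%:C : R[i])}.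
Proof.
move=> gc A /nbhs_rnormP[e e0 eA].
have : \forall t \near x, `|g x - g t| < e by move/cvgrPdist_lt: gc; exact.
apply: filterS => t gt; apply: eA.
by rewrite rnorm_cnorm -rmorphB cnorm_real distrC.
Qed.

Lemma rnorm_continuous (T : topologicalType) (V : normedModType R[i])
    (g : T -> V) x :
  {for x, continuous g} -> {for x, continuous (fun t => rnorm (g t))}.
Proof.
move=> gc; apply/cvgrPdist_lt => e e0.
have ge : nbhs (g x) [set v | rnorm (v - g x) < e].
  by apply/nbhs_rnormP; exists e.
have : \forall t \near x, rnorm (g t - g x) < e by exact: gc _ ge.
apply: filterS => t; apply: le_lt_trans; rewrite ler_norml.
have := rnormD (g t - g x) (g x); have := rnormD (g x - g t) (g t).
by rewrite !subrK (rnormBC (g x)) => *; apply/andP; split; lra.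
Qed.

(** The radius [1 / 3] of the support keeps it inside a closed polydisc of the
    ball of radius [1], see [closed_polysquare]. *)
Definition cutoff (s : R) : R := Num.max 0 (Num.min 1 (2 - 6 * s)).

Lemma cutoff_itv s : 0 <= cutoff s <= 1.
Proof. by rewrite /cutoff le_max lexx /= ge_max ler01 /= ge_min lexx. Qed.

Lemma cutoff1 s : s <= 1 / 6 -> cutoff s = 1.
Proof.
move=> s6; rewrite /cutoff; have -> : Num.min 1 (2 - 6 * s) = 1.
  by apply/min_idPl; lra.
by apply/max_idPr.
Qed.

Lemma cutoff0 s : 1 / 3 <= s -> cutoff s = 0.
Proof.
by move=> s3; rewrite /cutoff; apply/max_idPl; rewrite ge_min; apply/orP; right;
  lra.
Qed.

Lemma cutoff_continuous (T : topologicalType) (g : T -> R) x :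
  {for x, continuous g} -> {for x, continuous (fun t => cutoff (g t))}.
Proof.
move=> gc; apply: continuous_max; first exact: cvg_cst.
apply: continuous_min; first exact: cvg_cst.
by apply: cvgB; [exact: cvg_cst|apply: cvgM; [exact: cvg_cst|exact: gc]].
Qed.

(** Linear interpolation in the coordinates of [d], weighted by a cut-off around
    [p], does not leave the coordinate ball, which is convex. *)
Lemma modify_near (f m : X -> X) p (W : set X) d k e :
  continuous f -> nbhs p W -> atlas d -> chart_ball d k setT e ->
  (\forall q \near p, chart_dom d (f q) /\ rnorm (d (f q) - d k) < e) ->
  (\forall q \near p, chart_dom d (m q) /\ rnorm (d (m q) - d k) < e) ->
  (\forall q \near p, {for q, continuous m}) ->
  exists2 f1 : X -> X, continuous f1 &
    (forall q, ~ W q -> f1 q = f q) /\ \forall q \near p, f1 q = m q.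
Proof.
move=> fc pW ad [e0 _ eP] fd md mc.
have [c ac cp] := atlas_cover p.
have pA : nbhs p (W `&`
    ([set q | chart_dom d (f q) /\ rnorm (d (f q) - d k) < e]
    `&` ([set q | chart_dom d (m q) /\ rnorm (d (m q) - d k) < e]
    `&` [set q | {for q, continuous m}]))).
  by do 3![apply: filterI => //].
have [r ball_r] := chart_ball_ex ac cp pA; have [r0 rA rP] := ball_r.
have r3 : 0 < r / 3 by lra.
have r23 : 2 * (r / 3) < r by lra.
have [C [Ccl Cc CP]] := closed_polysquare ac ball_r r3 r23.
pose B := [set q | chart_dom c q /\ rnorm (c q - c p) < r].
have Bop : open B.
  rewrite openE => q [cq qr].
  have s0 : 0 < r - rnorm (c q - c p) by rewrite subr_gt0.
  have := chart_continuous ac cq s0; apply: filterS => q' [cq' q'r].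
  split=> //; have := rnormD (c q' - c q) (c q - c p).
  by rewrite addrA subrK; lra.
pose t q := cutoff (rnorm (c q - c p) / r).
pose z q := d (f q) + (t q)%:C *: (d (m q) - d (f q)).
pose f1 q := if pselect (B q) then chart_inv d k (z q) else f q.
have f1B q : B q -> f1 q = chart_inv d k (z q).
  by rewrite /f1; case: pselect.
have zB q : B q -> rnorm (z q - d k) < e.
  move=> [cq qr]; have [_ [[_ fe] [[_ me] _]]] := rA q cq qr.
  have /andP[t0 t1] := cutoff_itv (rnorm (c q - c p) / r).
  rewrite -/(t q) in t0 t1.
  have -> : z q - d k = (1 - t q)%:C *: (d (f q) - d k) +
      (t q)%:C *: (d (m q) - d k).
    by rewrite /z rmorphB rmorph1; apply/matrixP => i j; rewrite !mxE; ring.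
  apply: le_lt_trans (rnormD _ _) _; rewrite !rnormZ !cnorm_real !ger0_norm //.
    have := ler_wpM2l t0 (ltW me); have [t1'|t1'] := ltP (t q) 1.
      have : (1 - t q) * rnorm (d (f q) - d k) < (1 - t q) * e.
        by rewrite ltr_pM2l // subr_gt0.
      lra.
    have -> : t q = 1 by lra.
    by rewrite subrr mul0r add0r mul1r.
  by rewrite subr_ge0.
have f1C q : ~ C q -> f1 q = f q.
  move=> nCq; have [Bq|nBq] := pselect (B q); last by rewrite /f1; case: pselect.
  rewrite f1B //; have [cq qr] := Bq.
  have [_ [[fdq _] _]] := rA q cq qr.
  have tq : t q = 0.
    apply: cutoff0; rewrite ler_pdivlMr // leNgt; apply/negP => qr3.
    apply: nCq; apply/CP => // j; apply: csquare_cnorm.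
    have := coord_le_rnorm (c q - c p) j; rewrite !mxE; lra.
  by rewrite /z tq scale0r addr0 chartK.
exists f1; last split.
- move=> q; have [Bq|nBq] := pselect (B q); last first.
    have nCq : ~ C q.
      move=> Cq; apply: nBq; split; first exact: Cc.
      apply: le_lt_trans r23; apply: rnorm_le => [|j].
        by rewrite mulr_ge0 // ltW.
      by rewrite !mxE; apply: csquare_dist; move: j; apply/CP => //; exact: Cc.
    have nCop : open (~` C) by exact: closed_openC.
    have E : \forall q' \near q, f q' = f1 q'.
      by apply: filterS (open_nbhs_nbhs (conj nCop nCq)) => q' /f1C.
    rewrite /continuous_at (f1C _ nCq); apply: cvg_trans (near_eq_cvg E) _.
    exact: fc.
  have E : \forall q' \near q, chart_inv d k (z q') = f1 q'.
    by apply: filterS (open_nbhs_nbhs (conj Bop Bq)) => q' /f1B.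
  rewrite /continuous_at (f1B _ Bq); apply: cvg_trans (near_eq_cvg E) _.
  have [cq qr] := Bq; have [_ [[fdq _] [[mdq _] mcq]]] := rA q cq qr.
  have [_ cc _ _ _] := atlas_chart ac; have [_ dc _ _ _] := atlas_chart ad.
  have dfc : {for q, continuous (fun q => d (f q))}.
    exact: continuous_comp (fc q) (dc _ fdq).
  have dmc : {for q, continuous (fun q => d (m q))}.
    exact: continuous_comp mcq (dc _ mdq).
  have tc : {for q, continuous t}.
    apply: cutoff_continuous; apply: cvgM; last exact: cvg_cst.
    have cpc : {for q, continuous (fun q => c q - c p)}.
      by apply: cvgB; [exact: cc|exact: cvg_cst].
    exact: rnorm_continuous cpc.
  have zc : {for q, continuous z}.
    apply: cvgD; first exact: dfc.
    apply: cvgZ; first exact: real_complex_continuous.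
    by apply: cvgB; [exact: dmc|exact: dfc].
  have [q' dq' q'z] := eP _ (zB _ Bq).
  have ic : {for z q, continuous (chart_inv d k)}.
    by rewrite -q'z; exact: chart_inv_continuous.
  exact: continuous_comp zc ic.
- move=> q nWq; apply: f1C => Cq; apply: nWq.
  have cq := Cc _ Cq; have [|//] := rA q cq.
  apply: le_lt_trans r23; apply: rnorm_le => [|j].
    by rewrite mulr_ge0 // ltW.
  by rewrite !mxE; apply: csquare_dist; move: j; apply/CP.
- have r6 : 0 < r / 6 by lra.
  have := chart_continuous ac cp r6; apply: filterS => q [cq qr].
  have Bq : B q by split => //; lra.
  have [_ [_ [[mdq _] _]]] := rA q cq Bq.2.
  rewrite f1B // /z /t cutoff1; last by rewrite ler_pdivrMr //; lra.
  by rewrite rmorph1 scale1r addrC subrK chartK.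
Qed.

(** * Interpolation from the Oka property *)

(** Connectedness of the manifold makes the replacement possible without any
    condition on the values: the value at the point can be moved along a chain
    of coordinate balls. *)
Lemma replace_near (f m : X -> X) p (W : set X) : connected [set: X] ->
  continuous f -> nbhs p W -> (\forall q \near p, {for q, continuous m}) ->
  exists2 f1 : X -> X, continuous f1 &
    (forall q, ~ W q -> f1 q = f q) /\ \forall q \near p, f1 q = m q.
Proof.
move=> conX fc pW mc.
pose T := [set k | exists2 f1 : X -> X, continuous f1 &
  (forall q, ~ W q -> f1 q = f q) /\ \forall q \near p, f1 q = k].
have chartO k0 : exists d e, [/\ atlas d, chart_ball d k0 setT e, 0 < e &
    chart_dom d k0].
  have [d ad dk] := atlas_cover k0.
  have [e be] := chart_ball_ex ad dk (filterT : nbhs k0 setT).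
  by exists d, e; split => //; case: be.
have step k0 : \forall k \near k0, T k <-> T k0.
  have [d [e [ad be e0 dk]]] := chartO k0.
  have move_in k k' : chart_dom d k /\ rnorm (d k - d k0) < e ->
      chart_dom d k' /\ rnorm (d k' - d k0) < e -> T k -> T k'.
    move=> hk hk' [f1 f1c [f1f f1k]].
    have [|||f2 f2c [f2f f2k]] :=
      @modify_near f1 (fun=> k') p W d k0 e f1c pW ad be.
    - by apply: filterS f1k => q ->.
    - exact: nearW.
    - by apply: nearW => q; exact: cvg_cst.
    by exists f2 => //; split => // q nWq; rewrite f2f // f1f.
  have k0e : chart_dom d k0 /\ rnorm (d k0 - d k0) < e by rewrite subrr rnorm0.
  apply: filterS (chart_continuous ad dk e0) => k hk.
  by split; exact: move_in.
have [f1 f1c [f1f f1k]] : T (m p).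
  apply: connected_clopen_set => //.
  - by move=> k Tk; apply: filterS (step k) => k' h; apply/h.
  - by move=> k nTk; apply: filterS (step k) => k' h /h.
  exists (f p); have [d [e [ad be e0 dk]]] := chartO (f p).
  have near_fp : \forall q \near p, chart_dom d (f q) /\ rnorm (d (f q) - d (f p)) < e.
    exact: fc p _ (chart_continuous ad dk e0).
  apply: (@modify_near f (fun=> f p) p W d (f p) e fc pW ad be near_fp).
    by apply: nearW => q; rewrite subrr rnorm0.
  by apply: nearW => q; exact: cvg_cst.
have [d [e [ad be e0 dk]]] := chartO (m p).
have [||f2 f2c [f2f f2m]] := @modify_near f1 m p W d (m p) e f1c pW ad be _ _ mc.
- by apply: filterS f1k => q ->; rewrite subrr rnorm0.
- exact: (nbhs_singleton mc) _ (chart_continuous ad dk e0).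
by exists f2 => //; split => // q nWq; rewrite f2f // f1f.
Qed.

Lemma closed_nbhs p (A : set X) : nbhs p A ->
  exists C : set X, [/\ closed C, nbhs p C & C `<=` A].
Proof.
move=> pA; have [c ac cp] := atlas_cover p.
have [e be] := chart_ball_ex ac cp pA; have [e0 eA eP] := be.
have r0 : 0 < e / 3 by lra.
have r1 : 2 * (e / 3) < e by lra.
have [C [Ccl Cc CP]] := closed_polysquare ac be r0 r1.
exists C; split => //.
  apply: filterS (chart_continuous ac cp r0) => q [cq qe]; apply/CP => // j.
  apply: csquare_cnorm; apply: le_trans (ltW qe).
  by have := coord_le_rnorm (c q - c p) j; rewrite !mxE.
move=> q Cq; have cq := Cc _ Cq; apply: eA => //.
apply: le_lt_trans r1; apply: rnorm_le => [|j]; first lra.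
by rewrite !mxE; apply: csquare_dist; move: j; apply/CP.
Qed.

Lemma germ_holomorphic_coord n n' (F : 'rV[R[i]]_n -> 'rV[R[i]]_n') a j :
  germ_holomorphic F a -> germ_holomorphic (fun z => F z ord0 j) a.
Proof.
apply: filterS => z Fz.
apply: (@differentiable_comp _ _ _ _ F (fun v : 'rV[R[i]]_n' => v ord0 j)) => //.
exact: differentiable_coord.
Qed.

Lemma fun_holomorphic_coord c p (j : 'I_(chart_dim c)) (k : R[i]) : atlas c ->
  chart_dom c p -> fun_holomorphic_at (fun q => c q ord0 j - k) p.
Proof.
move=> ac cp c' ac' c'p; have [F [Fh cF]] := atlas_compatible ac' ac c'p cp.
exists (fun z => F z ord0 j - k); split.
  apply: filterS (germ_holomorphic_coord j Fh) => z Fz.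
  by apply: differentiableB => //; exact: differentiable_cst.
by apply: filterS cF => q ->.
Qed.

Lemma fun_holomorphic_cst (k : R[i]) p : fun_holomorphic_at (fun _ : X => k) p.
Proof.
move=> c ac cp; exists (fun=> k); split; last exact: nearW.
apply/nbhs_rnormP; exists 1 => // z _; exact: differentiable_cst.
Qed.

Lemma closed_subvariety1 p : closed_subvariety [set p].
Proof.
move=> p'; have [<-|pp'] := pselect (p = p').
  have [c ac cp] := atlas_cover p.
  exists (chart_dim c), (fun i q => c q ord0 i - c p ord0 i); split.
    by move=> i; exact: fun_holomorphic_coord.
  have [cop _ cinj _ _] := atlas_chart ac.
  apply: filterS (open_nbhs_nbhs (conj cop cp)) => q cq; split=> [-> i|cqp].
    by rewrite subrr.
  apply: (cinj _ _ (mem_set cq) (mem_set cp)); apply/rowP => i.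
  by apply/eqP; rewrite -subr_eq0 cqp.
exists 1%N, (fun _ _ => 1); split; first by move=> i; exact: fun_holomorphic_cst.
have np : open (~` [set p]).
  by apply: closed_openC; apply: compact_closed;
    [exact: space_hausdorff|exact: compact_set1].
have np' : (~` [set p]) p' by move=> /= /esym.
apply: filterS (open_nbhs_nbhs (conj np np')) => q qp; split => // /(_ ord0) /eqP.
by rewrite oner_eq0.
Qed.

Lemma holomorphic_at_near (f g : X -> X) p : (\forall q \near p, f q = g q) ->
  holomorphic_at f p -> holomorphic_at g p.
Proof.
move=> fg [fc fh]; have fgp := nbhs_singleton fg; split.
  suff : g x @[x --> p] --> g p by [].
  by rewrite -fgp; apply: cvg_trans fc; exact: near_eq_cvg.
move=> c d ac ad cp dgp; rewrite -fgp in dgp.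
have [F [Fh fF]] := fh c d ac ad cp dgp; exists F; split => //.
by apply: filterS (filterI fg fF) => q [/= <-].
Qed.

(** The Oka property applies to a map which is already holomorphic near [K] and
    near [p].  Such a map is obtained from [f] by a change inside a closed
    neighbourhood of [p] disjoint from [K], and there the germ is free. *)
Lemma oka_interpolation (f m : X -> X) p (K : set X) k (V : set (X * X)) :
  oka X -> stein X -> connected [set: X] -> compact K ->
  holomorphically_convex K -> ~ K p -> holomorphic_map f ->
  (\forall q \near p, holomorphic_at m q) -> open V ->
  (forall q, K q -> V (q, f q)) ->
  exists g : X -> X, [/\ holomorphic_map g, forall q, K q -> V (q, g q),
    g p = m p & forall d, atlas d -> chart_dom d (m p) -> forall j,
      in_ideal_power [set p] k.+1 p (fun q => d (g q) ord0 j - d (m q) ord0 j)].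
Proof.
move=> okaX steinX conX cptK cvxK nKp fh mh Vop Vf.
have Kcl : closed K by apply: compact_closed => //; exact: space_hausdorff.
have [W [Wcl pW WK]] : exists C : set X, [/\ closed C, nbhs p C & C `<=` ~` K].
  by apply: closed_nbhs; apply: open_nbhs_nbhs; split; [exact: closed_openC|].
have fc : continuous f by move=> q; case: (fh q).
have mc : \forall q \near p, {for q, continuous m}.
  by apply: filterS mh => q [].
have [f1 f1c [f1f f1m]] := replace_near conX fc pW mc.
have [U [Uop KTU Uh]] : exists U : set X, [/\ open U, K `|` [set p] `<=` U &
    forall q, U q -> holomorphic_at f1 q].
  exists ([set q | holomorphic_at f1 q]^°); split => //.
  - exact: open_interior.
  - move=> q [Kq|->].
      have nWop : open (~` W) by exact: closed_openC.
      have nWq : (~` W) q by move=> /WK.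
      apply: filterS (open_nbhs_nbhs (conj nWop nWq)) => q' nWq'.
      apply: holomorphic_at_near (fh q').
      by apply: filterS (open_nbhs_nbhs (conj nWop nWq')) => q'' /f1f.
    apply: filterS (filterI mh (near_join f1m)) => x [mx f1x].
    by apply: holomorphic_at_near mx; apply: filterS f1x => q' ->.
  - exact: interior_subset.
have Vf1 q : K q -> V (q, f1 q).
  by move=> Kq; rewrite f1f; [exact: Vf|move=> /WK].
have [H [_ H0 H1 HV HT]] := okaX _ steinX _ cptK cvxK _ (closed_subvariety1 p)
  _ f1c (ex_intro _ U (And3 Uop KTU Uh)) k _ Vop Vf1.
have f1p := nbhs_singleton f1m.
have t1 : 0 <= (1 : R) <= 1 by rewrite ler01 lexx.
exists (fun q => H (1, q)); split => //.
- by move=> q; exact: HV.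
- by have [] := HT 1 t1 p erefl; rewrite f1p => ->.
move=> d ad dm j; have [_ /(_ d ad)] := HT 1 t1 p erefl.
rewrite f1p => /(_ dm j) [n [a [u [ah uh uT E]]]]; exists n, a, u; split => //.
by apply: filterS (filterI E f1m) => q [/= <- <-].
Qed.

(** * The parabolic map in one variable *)

Section reciprocal.
Variables (A a : R).
Hypotheses (A0 : 0 <= A) (aA : 16 + 96 * A <= `|a|).

Lemma inv_near_bounds (x : R[i]) : N (x^-1 - a%:C) <= 1 ->
  [/\ x != 0, N x <= 2 / `|a| & 1 / (2 * `|a|) <= N x].
Proof.
move=> xa; have a16 : 16 <= `|a| by move: A0 aA; lra.
have Na : N a%:C = `|a| by rewrite cnorm_real.
have lo : `|a| - 1 <= N x^-1.
  by have := cnormB (x^-1) (x^-1 - a%:C); rewrite subKr Na; lra.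
have hi : N x^-1 <= `|a| + 1.
  by have := cnormD (x^-1 - a%:C) a%:C; rewrite subrK Na; lra.
have x0 : x != 0.
  by rewrite -invr_eq0 -cnorm_gt0; lra.
have Nx0 : 0 < N x by rewrite cnorm_gt0.
rewrite cnormV in lo hi; split => //.
  rewrite ler_pdivlMr; last lra.
  rewrite -ler_pdivlMl // mulrC; lra.
rewrite ler_pdivrMr; last lra.
rewrite -ler_pdivrMl // mulr1; lra.
Qed.

(** In the coordinate [1 / x] the map [x - x ^ 2 + x ^ 3] is the translation
    by [1] up to an error of order [x ^ 2], because
    [(1 / x + 1) (x - x ^ 2 + x ^ 3) = 1 + x ^ 3]; the cubic term is there to
    make these errors summable along orbits. *)
Lemma inv_parabolic_step (x e : R[i]) (r : R) : r <= 1 ->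
  N (x^-1 - a%:C) <= r -> N e <= 16 * A / `|a| ^+ 4 ->
  N ((x - x ^+ 2 + x ^+ 3 + e)^-1 - (a + 1)%:C) <=
    r + (48 + 288 * A) / `|a| ^+ 2.
Proof.
move=> r1 xr eA; set b : R := `|a| in eA *.
have [x0 x_hi _] := inv_near_bounds (le_trans xr r1); rewrite -/b in x_hi.
have b16 : 16 <= b by move: A0 aA; rewrite -/b; lra.
have b0 : 0 < b by lra.
have Nz : N (x^-1 + 1) <= 3 * b.
  have := cnormD (x^-1 - a%:C) (a%:C + 1).
  have := cnormD a%:C 1; rewrite cnorm1 cnorm_real -/b.
  by rewrite addrA subrK; lra.
set z := x^-1 + 1 in Nz *.
set y := x - x ^+ 2 + x ^+ 3 + e.
set dl := x ^+ 3 + z * e.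
have zy : z * y = 1 + dl by rewrite /dl /z /y; field.
have e_le : N (z * e) <= 3 * b * (16 * A / b ^+ 4).
  by rewrite cnormM; apply: ler_pM => //; exact: cnorm_ge0.
have x3_le : N (x ^+ 3) <= (2 / b) ^+ 3.
  by rewrite cnormX lerXn2r ?nnegrE ?cnorm_ge0 // divr_ge0 // ltW.
have dl_le : N dl <= (8 + 48 * A) / b ^+ 3.
  have := cnormD (x ^+ 3) (z * e); rewrite -/dl.
  have -> : (8 + 48 * A) / b ^+ 3 = (2 / b) ^+ 3 + 3 * b * (16 * A / b ^+ 4).
    by field; rewrite gt_eqF.
  lra.
have dl2 : N dl <= 1 / 2.
  apply: le_trans dl_le _; rewrite ler_pdivrMr ?exprn_gt0 //.
  have : b * 1 <= b * (b ^+ 2) by rewrite ler_pM2l // exprn_ege1 //; lra.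
  by rewrite mulr1 -exprS; move: aA; rewrite -/b; lra.
have Nd1 : 1 / 2 <= N (1 + dl) by have := cnorm_lowerD 1 dl; rewrite cnorm1; lra.
have d10 : 1 + dl != 0 by rewrite -cnorm_gt0; lra.
have y0 : y != 0 by apply: contraNneq d10 => y0; rewrite -zy y0 mulr0.
have E : y^-1 - (a + 1)%:C = (x^-1 - a%:C) - z * dl / (1 + dl).
  have -> : y^-1 = z / (1 + dl) by rewrite -zy; field; rewrite y0 -zy in d10 *;
    move: d10; rewrite mulf_eq0 negb_or => /andP[-> _].
  have -> : x^-1 = z - 1 by rewrite /z addrK.
  rewrite rmorphD rmorph1; move: (dl) d10 (z) => dl' d10' z'.
  by field.
rewrite E; apply: le_trans (cnormB _ _) _; apply: lerD => //.
rewrite cnorm_div cnormM.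
have h1 : N z * N dl <= 3 * b * ((8 + 48 * A) / b ^+ 3).
  by apply: ler_pM => //; exact: cnorm_ge0.
rewrite ler_pdivrMr; last lra.
apply: le_trans h1 _.
have -> : 3 * b * ((8 + 48 * A) / b ^+ 3) = (48 + 288 * A) / b ^+ 2 * (1 / 2).
  by field; rewrite gt_eqF.
have C0 : 0 <= (48 + 288 * A) / b ^+ 2.
  by apply: divr_ge0; [move: A0; lra|apply: exprn_ge0; exact: ltW].
exact: ler_wpM2l C0 _ _ Nd1.
Qed.

End reciprocal.

(** * Parabolic germs on manifolds *)

Lemma fun_holomorphic_lipschitz (u : X -> R[i]) c p : atlas c ->
  chart_dom c p -> fun_holomorphic_at u p -> exists2 C : R, 0 < C &
    \forall q \near p, N (u q - u p) <= C * rnorm (c q - c p).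
Proof.
move=> ac cp uh; have [F [Fh uF]] := uh c ac cp.
have [C C0 [d d0 dP]] := differentiable_lipschitz_at (nbhs_singleton Fh).
exists C => //; apply: filterS (filterI uF (chart_continuous ac cp d0)).
move=> q [/= -> [_ /dP]]; rewrite (nbhs_singleton uF) -rnorm_cnorm.
by [].
Qed.

Lemma ideal_power_bound c p k (h : X -> R[i]) : atlas c -> chart_dom c p ->
  in_ideal_power [set p] k p h -> exists2 A : R, 0 <= A &
    \forall q \near p, N (h q) <= A * rnorm (c q - c p) ^+ k.
Proof.
move=> ac cp [n [a [u [ah uh u0 hE]]]].
have /choice[B BP] : forall i, exists B : R, 0 <= B /\
    \forall q \near p, N (a i q) <= B.
  move=> i; have [C C0 CP] := fun_holomorphic_lipschitz ac cp (ah i).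
  exists (N (a i p) + C); split; first by rewrite addr_ge0 ?cnorm_ge0 // ltW.
  apply: filterS (filterI CP (chart_continuous ac cp ltr01)) => q [/= h1 [_ h2]].
  have := cnormD (a i q - a i p) (a i p); rewrite subrK.
  have : C * rnorm (c q - c p) <= C * 1 by rewrite ler_pM2l // ltW.
  lra.
have /choice[C CP] : forall ij : 'I_n * 'I_k, exists C : R, 0 <= C /\
    \forall q \near p, N (u ij.1 ij.2 q) <= C * rnorm (c q - c p).
  move=> [i j] /=; have [C C0 CP] := fun_holomorphic_lipschitz ac cp (uh i j).
  exists C; split; first exact: ltW.
  by apply: filterS CP => q; rewrite (nbhs_singleton (u0 i j)) // subr0.
exists (\sum_i B i * \prod_j C (i, j)).
  apply: sumr_ge0 => i _; apply: mulr_ge0; first by case: (BP i).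
  by apply: prodr_ge0 => j _; case: (CP (i, j)).
have aB : \forall q \near p, forall i, N (a i q) <= B i.
  by apply: filter_forall => i; case: (BP i).
have uC : \forall q \near p, forall ij, N (u ij.1 ij.2 q) <= C ij * rnorm (c q - c p).
  by apply: filter_forall => i; case: (CP i).
apply: filterS (filterI hE (filterI aB uC)) => q [/= -> [aBq uCq]].
apply: le_trans (cnorm_sum _ _ _) _; rewrite mulr_suml; apply: ler_sum => i _.
rewrite cnormM -mulrA; apply: ler_pM => //; try exact: cnorm_ge0.
have -> : (\prod_j C (i, j)) * rnorm (c q - c p) ^+ k =
    \prod_(j < k) (C (i, j) * rnorm (c q - c p)).
  by rewrite big_split /= prodr_const card_ord.
have -> : N (\prod_j u i j q) = \prod_j N (u i j q).
  by apply: (big_morph (@cnorm R)) => [z w|]; [exact: cnormM|exact: cnorm1].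
apply: ler_prod => j _; rewrite cnorm_ge0; exact: (uCq (i, j)).
Qed.

Lemma differentiable_row n n' (F : 'rV[R[i]]_n -> 'rV[R[i]]_n') x :
  (forall j, differentiable (fun z => F z ord0 j) x) -> differentiable F x.
Proof.
move=> Fj; have -> : F = \sum_j (fun z => F z ord0 j *: 'e_j).
  by apply: funext => z; rewrite fct_sumE; exact: row_sum_delta.
by apply: differentiable_sum => j; exact: differentiableZl.
Qed.

Lemma germ_holomorphicT n (W : normedModType R[i]) (F : 'rV[R[i]]_n -> W) a :
  (forall z, differentiable F z) -> germ_holomorphic F a.
Proof. by move=> Fd; apply/nbhs_rnormP; exists 1 => [|z _]; [exact: ltr01|]. Qed.

(** All coordinates of an attracted orbit decay at the same rate, so that an
    error of fourth order in the norm is of fourth order in each coordinate. *)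
Definition parabolic n (a z : 'rV[R[i]]_n) : 'rV[R[i]]_n := \row_j
  (a ord0 j + ((z ord0 j - a ord0 j) - (z ord0 j - a ord0 j) ^+ 2
               + (z ord0 j - a ord0 j) ^+ 3)).

Lemma differentiable_parabolic n (a z : 'rV[R[i]]_n) :
  differentiable (parabolic a) z.
Proof.
apply: differentiable_row => j.
have -> : (fun z => parabolic a z ord0 j) = cst (a ord0 j) +
    (((fun z : 'rV[R[i]]_n => z ord0 j) - cst (a ord0 j)) -
     ((fun z : 'rV[R[i]]_n => z ord0 j) - cst (a ord0 j)) ^+ 2 +
     ((fun z : 'rV[R[i]]_n => z ord0 j) - cst (a ord0 j)) ^+ 3).
  by apply: funext => w; rewrite /parabolic mxE.
have dc : differentiable ((fun z : 'rV[R[i]]_n => z ord0 j) - cst (a ord0 j)) z.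
  apply: differentiableB; first exact: differentiable_coord.
  exact: differentiable_cst.
move: (_ - cst _) dc => h dc.
apply: differentiableD; first exact: differentiable_cst.
apply: differentiableD; last exact: differentiableX.
by apply: differentiableB; [exact: dc|exact: differentiableX].
Qed.

Lemma germ_holomorphic_parabolic n (a z : 'rV[R[i]]_n) :
  germ_holomorphic (parabolic a) z.
Proof.
by apply: germ_holomorphicT => w; exact: differentiable_parabolic.
Qed.

Lemma germ_holomorphic_comp n n' n'' (F : 'rV[R[i]]_n -> 'rV[R[i]]_n')
    (G : 'rV[R[i]]_n' -> 'rV[R[i]]_n'') a :
  germ_holomorphic F a -> germ_holomorphic G (F a) -> germ_holomorphic (G \o F) a.
Proof.
move=> Fh Gh; have Fc := differentiable_continuous (nbhs_singleton Fh).
have GF : \forall z \near a, differentiable G (F z) by exact: Fc _ Gh.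
by apply: filterS (filterI Fh GF) => z [/= ? ?]; exact: differentiable_comp.
Qed.

(** The transition maps carry a local representation in one pair of charts to
    all other pairs. *)
Lemma holomorphic_at_chart (f : X -> X) p c d
    (F : 'rV[R[i]]_(chart_dim c) -> 'rV[R[i]]_(chart_dim d)) :
  atlas c -> atlas d -> chart_dom c p -> chart_dom d (f p) ->
  {for p, continuous f} -> germ_holomorphic F (c p) ->
  (\forall q \near p, d (f q) = F (c q)) -> holomorphic_at f p.
Proof.
move=> ac ad cp dfp fc Fh fF; split=> // c' d' ac' ad' c'p d'fp.
have [G [Gh cG]] := atlas_compatible ac' ac c'p cp.
have [G' [G'h d'G']] := atlas_compatible ad ad' dfp d'fp.
have Gp := nbhs_singleton cG; have Fp := nbhs_singleton fF.
rewrite Fp Gp in G'h; rewrite Gp in Fh.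
exists (G' \o (F \o G)); split.
  exact: germ_holomorphic_comp (germ_holomorphic_comp Gh Fh) G'h.
have d'f : \forall q \near p, d' (f q) = G' (d (f q)) by exact: fc _ d'G'.
by apply: filterS (filterI cG (filterI fF d'f)) => q [/= h1 [h2 ->]]; rewrite h2 h1.
Qed.

Lemma parabolic_germ c p : atlas c -> chart_dom c p -> exists m : X -> X,
  [/\ \forall q \near p, holomorphic_at m q, m p = p &
      \forall q \near p, chart_dom c (m q) /\ c (m q) = parabolic (c p) (c q)].
Proof.
move=> ac cp; have [_ cc _ _ _] := atlas_chart ac.
pose P := parabolic (c p).
have Pp : P (c p) = c p.
  by apply/rowP => j; rewrite /P /parabolic mxE subrr !expr0n /= subr0 !addr0.
have Pc z : {for z, continuous P}.
  by apply: differentiable_continuous; exact: differentiable_parabolic.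
have [e [e0 _ eP]] := chart_ball_ex ac cp (filterT : nbhs p setT).
pose m q := chart_inv c p (P (c q)).
have mnear : \forall q \near p, chart_dom c q /\ rnorm (P (c q) - c p) < e.
  have Pce : \forall z \near c p, rnorm (P z - c p) < e.
    have h : nbhs (P (c p)) [set w | rnorm (w - c p) < e].
      by rewrite Pp; apply/nbhs_rnormP; exists e.
    exact: Pc (c p) _ h.
  apply: filterS (filterI (chart_continuous ac cp e0) (cc p cp _ Pce)).
  by move=> q [[]].
have mP q : chart_dom c q /\ rnorm (P (c q) - c p) < e ->
    chart_dom c (m q) /\ c (m q) = P (c q).
  by move=> [cq qe]; apply: chart_invK; exact: eP.
exists m; split.
- apply: filterS (near_join mnear) => q mq.
  have [cq qe] := nbhs_singleton mq; have [cmq mqP] := mP _ (conj cq qe).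
  apply: (@holomorphic_at_chart m q c c P) => //.
  + have ic : {for P (c q), continuous (chart_inv c p)}.
      by rewrite -mqP; exact: chart_inv_continuous.
    have Pcc : {for q, continuous (P \o c)}.
      exact: continuous_comp (cc q cq) (Pc (c q)).
    exact: continuous_comp Pcc ic.
  + rewrite /P; exact: germ_holomorphic_parabolic.
  + by apply: filterS mq => q' /mP[].
- by rewrite /m Pp chartK.
- by apply: filterS mnear => q /mP.
Qed.

(** * Petals *)

(** In the coordinates [1 / x] the parabolic map is close to a translation by
    [1]; for large [a > 0] these points are attracted to [p], for large [a < 0]
    they come from [p]. *)
Definition petal c p (a r : R) : set X := [set q | chart_dom c q /\
  forall j, N ((c q ord0 j - c p ord0 j)^-1 - a%:C) <= r].

Definition parabolic_at c p (g : X -> X) := exists2 A : R, 0 <= A &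
  \forall q \near p, chart_dom c (g q) /\ forall j,
    N (c (g q) ord0 j - parabolic (c p) (c q) ord0 j) <=
      A * rnorm (c q - c p) ^+ 4.

Lemma petal_small c p a r q : 16 <= `|a| -> r <= 1 -> petal c p a r q ->
  rnorm (c q - c p) <= 2 / `|a|.
Proof.
move=> a16 r1 [_ qa]; apply: rnorm_le => [|j].
  by rewrite divr_ge0.
rewrite !mxE.
have h : 16 + 96 * 0 <= `|a| by lra.
by have [] := inv_near_bounds (lexx 0) h (le_trans (qa j) r1).
Qed.

Lemma petal_big c p a r q : (0 < chart_dim c)%N -> 16 <= `|a| -> r <= 1 ->
  petal c p a r q -> 1 / (2 * `|a|) <= rnorm (c q - c p).
Proof.
move=> n0 a16 r1 [_ qa]; have h : 16 + 96 * 0 <= `|a| by lra.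
have [_ _] := inv_near_bounds (lexx 0) h (le_trans (qa (Ordinal n0)) r1).
move=> /le_trans; apply; have := coord_le_rnorm (c q - c p) (Ordinal n0).
by rewrite !mxE.
Qed.

Lemma petal_step c p g : atlas c -> chart_dom c p -> parabolic_at c p g ->
  exists B C : R, [/\ 16 <= B, 0 < C, 2 * C <= B & forall a r q,
    B <= `|a| -> r <= 1 -> petal c p a r q ->
    petal c p (a + 1) (r + C / `|a| ^+ 2) (g q)].
Proof.
move=> ac cp [A A0 gP]; have [e e0 eP] := chart_nbhs ac cp gP.
have e4 : 0 < 4 / e by rewrite divr_gt0.
exists (2 * (48 + 288 * A) + 4 / e), (48 + 288 * A).
split; [lra|lra|lra|move=> a r q aB r1 qa].
have [cq qaj] := qa.
have a16 : 16 <= `|a| by lra.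
have aA : 16 + 96 * A <= `|a| by lra.
have qs := petal_small a16 r1 qa.
have a0 : 0 < `|a| by lra.
have [|cgq gqj] := eP q cq.
  apply: le_lt_trans qs _; rewrite ltr_pdivrMr // mulrC -ltr_pdivrMr //.
  have : 2 / e < 4 / e by rewrite ltr_pM2r ?invr_gt0 //; lra.
  lra.
split=> // j; set x := c q ord0 j - c p ord0 j.
set err := c (g q) ord0 j - parabolic (c p) (c q) ord0 j.
have -> : c (g q) ord0 j - c p ord0 j = x - x ^+ 2 + x ^+ 3 + err.
  by rewrite /err /parabolic mxE -/x; ring.
apply: inv_parabolic_step => //; first exact: qaj.
apply: le_trans (gqj j) _.
have -> : 16 * A / `|a| ^+ 4 = A * (2 / `|a|) ^+ 4 by field; rewrite gt_eqF.
by rewrite ler_wpM2l // lerXn2r ?nnegrE ?rnorm_ge0 // divr_ge0.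
Qed.

Section petal_orbits.
Variables (c : chart R X) (p : X) (g : X -> X) (B C : R).
Hypotheses (B16 : 16 <= B) (C0 : 0 < C) (CB : 2 * C <= B).
Hypothesis gstep : forall a r q, B <= `|a| -> r <= 1 -> petal c p a r q ->
  petal c p (a + 1) (r + C / `|a| ^+ 2) (g q).

Lemma petal_sub a r r' q : r <= r' -> petal c p a r q -> petal c p a r' q.
Proof. by move=> rr' [cq qa]; split => // j; exact: le_trans (qa j) rr'. Qed.

(** The errors of successive steps are bounded by a telescoping sum. *)
Lemma telescope b : 16 <= b -> C / b ^+ 2 <= C / (b - 1) - C / b.
Proof.
move=> b16; have -> : C / (b - 1) - C / b = C / (b * (b - 1)).
  by field; apply/andP; split; rewrite gt_eqF //; lra.
rewrite ler_pM2l // lef_pV2 ?posrE.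
- rewrite expr2 ler_pM2l; lra.
- by rewrite exprn_gt0 //; lra.
- by rewrite mulr_gt0; lra.
Qed.

Lemma petal_forward a q : B <= a -> petal c p a (1 - C / (a - 1)) q ->
  forall n, petal c p (a + n%:R) (1 - C / (a + n%:R - 1)) (iter n g q).
Proof.
move=> aB qa; elim=> [|n IH]; first by rewrite addr0.
have n0 : (0 : R) <= n%:R by exact: ler0n.
have p0 : 0 <= C / (a + n%:R - 1).
  by apply: divr_ge0; move: B16 C0; lra.
have b16 : 16 <= a + n%:R by move: B16; lra.
have Nb : `|a + n%:R| = a + n%:R by rewrite ger0_norm //; lra.
have := gstep _ _ IH; rewrite Nb => /(_ (ltac:(lra)) (ltac:(lra))).
rewrite -addrA natr1; apply: petal_sub.
have := telescope b16.
have -> : a + n.+1%:R - 1 = a + n%:R by rewrite -natr1; ring.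
lra.
Qed.

Lemma petal_backward n q : petal c p (- (B + n%:R)) (C / (B + n%:R)) q ->
  petal c p (- B) (C / B) (iter n g q).
Proof.
elim: n q => [|n IH] q; first by rewrite addr0.
move=> qa; rewrite iterSr; apply: IH.
set b := B + n.+1%:R in qa.
have n0 : (0 : R) <= n%:R by exact: ler0n.
have bB : B + 1 <= b by rewrite /b -natr1; lra.
have b16 : 16 <= b by move: B16; lra.
have Nb : `|- b| = b by rewrite normrN ger0_norm //; lra.
have := gstep _ _ qa; rewrite Nb.
have r1 : C / b <= 1 by rewrite ler_pdivrMr; move: B16 CB C0; lra.
move=> /(_ (ltac:(lra)) r1).
have bn : B + n%:R = b - 1 by rewrite /b -natr1; ring.
rewrite bn opprB addrC; apply: petal_sub.
have := telescope b16; lra.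
Qed.

(** The convergence to [p] is uniform on the petal, as normality requires. *)
Lemma petal_attracted a (O : set X) : atlas c -> chart_dom c p -> B <= a ->
  nbhs p O -> exists n0, forall n, (n0 <= n)%N -> forall q,
  petal c p a (1 - C / (a - 1)) q -> O (iter n g q).
Proof.
move=> ac cp aB pO; have [e e0 eP] := chart_nbhs ac cp pO.
have hn := archi_boundP (ltW (divr_gt0 (ltr0n R 2) e0)).
set n0 := Num.Def.archi_bound _ in hn; exists n0 => n n0n q qa.
have := petal_forward aB qa n => qn; have [cqn _] := qn.
apply: eP => //.
have nn : (n0%:R : R) <= n%:R by rewrite ler_nat.
have n00 : (0 : R) <= n0%:R by exact: ler0n.
have b16 : 16 <= `|a + n%:R| by rewrite ger0_norm; move: B16; lra.
have r1 : 1 - C / (a + n%:R - 1) <= 1.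
  by rewrite gerBl divr_ge0 //; move: B16 C0; lra.
apply: le_lt_trans (petal_small b16 r1 qn) _.
rewrite ltr_pdivrMr; last lra.
rewrite mulrC -ltr_pdivrMr //; apply: lt_le_trans hn _.
rewrite ger0_norm; move: B16; lra.
Qed.

End petal_orbits.

Lemma petal_nbhs c p q (a r : R) : atlas c -> chart_dom c q -> 0 < r -> a != 0 ->
  (forall j, c q ord0 j - c p ord0 j = (a^-1)%:C) -> nbhs q (petal c p a r).
Proof.
move=> ac cq r0 a0 qj.
have near_j : \forall q' \near q, forall j,
    N ((c q' ord0 j - c p ord0 j)^-1 - a%:C) <= r.
  apply: filter_forall => j.
  have neq : c q ord0 j <> c p ord0 j.
    move=> E; have := qj j; rewrite E subrr => /esym/(congr1 (@complex.Re R)) /= /eqP.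
    by rewrite invr_eq0 (negbTE a0).
  have [d d0 dP] := cdiff_ccont (cdiff_inv_sub neq) r0.
  apply: filterS (chart_continuous ac cq d0) => q' [_ q'd].
  have -> : a%:C = (c q ord0 j - c p ord0 j)^-1.
    by rewrite qj -fmorphV /= invrK.
  apply: dP; apply: le_lt_trans q'd.
  by have := coord_le_rnorm (c q' - c q) j; rewrite !mxE.
have [cop _ _ _ _] := atlas_chart ac.
by apply: filterS (filterI (open_nbhs_nbhs (conj cop cq)) near_j) => q' [].
Qed.

(** The centres of the petals; in particular the petals are not empty. *)
Lemma diagonal_point c p : atlas c -> chart_dom c p -> exists2 a0 : R, 0 < a0 &
  forall a : R, a0 < `|a| -> exists2 q, chart_dom c q &
    forall j, c q ord0 j - c p ord0 j = (a^-1)%:C.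
Proof.
move=> ac cp; have [e e0 eP] := chart_surj ac cp.
exists e^-1; first by rewrite invr_gt0.
move=> a ae; have a0 : 0 < `|a| by apply: lt_trans ae; rewrite invr_gt0.
have [|q cq qz] := eP (c p + const_mx (a^-1)%:C).
  rewrite addrAC subrr add0r; apply: (@le_lt_trans _ _ (`|a|^-1)).
    apply: rnorm_le => [|j]; first by rewrite invr_ge0.
    by rewrite mxE cnorm_real normfV.
  by rewrite -[e]invrK ltf_pV2 // posrE ?invr_gt0.
by exists q => // j; rewrite qz !mxE addrAC subrr add0r.
Qed.

(** * The parabolic fixed point and the Fatou set *)

Lemma increasing_ge_id (s : nat -> nat) : increasing_seq s ->
  forall n, (n <= s n)%N.
Proof.
move=> /increasing_seqP sS; elim=> [//|n IH]; apply: leq_ltn_trans IH _.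
exact: sS.
Qed.

Lemma increasing_id : increasing_seq (fun n : nat => n).
Proof. by apply/increasing_seqP => n; exact: ltnSn. Qed.

Lemma infinite_increasing (P : nat -> Prop) :
  (forall n0, exists2 n, (n0 <= n)%N & P n) ->
  exists2 s : nat -> nat, increasing_seq s & forall k, P (s k).
Proof.
move=> Pinf; have /choice[f fP] : forall n0, exists n, (n0 <= n)%N /\ P n.
  by move=> n0; have [n ? ?] := Pinf n0; exists n.
pose s := fix s k := if k is k'.+1 then f (s k').+1 else f 0%N.
exists s; first by apply/increasing_seqP => n; case: (fP (s n).+1).
by case=> [|k] /=; apply: (fP _).2.
Qed.

Lemma compact_sequence_limit (x : nat -> X) p M :
  (forall A : set X, nbhs p A -> exists n0, forall n, (n0 <= n)%N -> A (x n)) ->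
  compact [set q | q = p \/ exists2 m, (M <= m)%N & q = x m].
Proof.
move=> xp F FF FK; have [pF|] := pselect (cluster F p).
  by exists p; split => //; left.
move=> /existsNP[B] /existsNP[A] /not_implyP[FB] /not_implyP[pA] /set0P/negP.
rewrite negbK => /eqP BA0; have [n0 n0P] := xp A pA.
pose D := x @` `I_n0.
have finD : finite_set D by apply: finite_image; exact: finite_II.
set K := [set q | _] in FK *.
have FKD : F (K `&` D).
  apply: filterS (filterI FK FB) => q [Kq Bq]; split => //.
  have nAq : ~ A q by move=> Aq; have : (B `&` A) q by []; rewrite BA0.
  case: Kq => [qp|[m _ qm]].
    by case: nAq; rewrite qp; exact: nbhs_singleton.
  exists m => //=; rewrite ltnNge; apply/negP => n0m.
  by apply: nAq; rewrite qm; exact: n0P.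
have [|q [[Kq Dq] cq]] := finite_compact (sub_finite_set _ finD) FF FKD.
  exact: subIsetr.
by exists q.
Qed.

Lemma cvg_to_pointP (x : nat -> X) p : x @ \oo --> p <->
  forall A : set X, nbhs p A -> exists n0, forall n, (n0 <= n)%N -> A (x n).
Proof.
split=> [xp A /xp[n0 _ n0P]|xp A /xp[n0 n0P]]; first by exists n0 => n; exact: n0P.
by exists n0.
Qed.

Lemma closed_point p : closed [set p].
Proof.
by apply: compact_closed; [exact: space_hausdorff|exact: compact_set1].
Qed.

Lemma open_neq p : open (~` [set p]).
Proof. by apply: closed_openC; exact: closed_point. Qed.

Lemma iter_fixed (g : X -> X) p n : g p = p -> iter n g p = p.
Proof. by move=> gp; elim: n => //= n ->. Qed.

(** The parabolic fixed point is not in the Fatou set: the limit of a sequence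
    of iterates would fix it and be continuous there, whereas orbits in the
    repelling direction start arbitrarily close to it and reach a fixed
    distance. *)
Lemma parabolic_not_fatou c p g : (0 < dimX)%N -> atlas c -> chart_dom c p ->
  g p = p -> parabolic_at c p g -> ~ fatou_set g p.
Proof.
move=> n0 ac cp gp gpar [U [Uop Up Ug]].
have c0 : (0 < chart_dim c)%N by have [dimc _] := manX ac; rewrite dimc.
have [t tinc Ht] := Ug _ increasing_id; case: Ht => [[h hh hU]|hU]; last first.
  have p1 : [set p] `<=` U by move=> _ ->.
  have [n1 _ /(_ n1 (leqnn _))] := hU _ _ (@compact_set1 _ p) p1 (@compact_set1 _ p).
  by move=> h; apply: (h p) => //; exists p => //; exact: iter_fixed.
have hp : h p = p.
  apply: contrapT => hp.
  have p1 : [set p] `<=` U by move=> _ ->.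
  have hp1 : h @` [set p] `<=` ~` [set p] by move=> _ [_ -> <-].
  have [n1 _ /(_ n1 (leqnn _))] := hU _ _ (@compact_set1 _ p) p1 (open_neq p) hp1.
  by move=> H; apply: (H p) => //; exists p => //; exact: iter_fixed.
have [B [C [B16 C0 CB gstep]]] := petal_step ac cp gpar.
pose S := [set q | chart_dom c q /\ rnorm (c q - c p) < 1 / (2 * B)].
have B0 : 0 < B by lra.
have pS : nbhs p S.
  by apply: chart_continuous => //; rewrite divr_gt0 //; lra.
have S_petal q : S q -> ~ petal c p (- B) (C / B) q.
  move=> [_ qS]; have NB : `|- B| = B by rewrite normrN gtr0_norm.
  move=> /(petal_big c0); rewrite NB => /(_ B16).
  have : C / B <= 1 by rewrite ler_pdivrMr //; lra.
  by move=> h1 /(_ h1); lra.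
have hc : nbhs p (h @^-1` S^°).
  have [hcp _] := hh p Up; apply: hcp; rewrite hp.
  by apply: open_nbhs_nbhs; split; [exact: open_interior|].
have [a0 a00 a0P] := diagonal_point ac cp.
have /choice[x xP] : forall m : nat, exists q, a0 < B + m%:R ->
    chart_dom c q /\
    forall j, c q ord0 j - c p ord0 j = ((- (B + m%:R))^-1)%:C.
  move=> m; have [am|am] := boolP (a0 < B + m%:R); last by exists p.
  have [|q cq qj] := a0P (- (B + m%:R)); last by exists q.
  by rewrite normrN (lt_le_trans am) // ler_norm.
have big (K : R) : exists m0 : nat, forall m, (m0 <= m)%N -> K < B + m%:R.
  exists (Num.Def.archi_bound `|K|) => m mK.
  have := archi_boundP (normr_ge0 K); have := ler_norm K.
  have : ((Num.Def.archi_bound `|K|)%:R : R) <= m%:R by rewrite ler_nat.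
  lra.
have [m0 m0P] := big a0.
have xcvg A : nbhs p A -> exists n0, forall n, (n0 <= n)%N -> A (x n).
  move=> /(chart_nbhs ac cp)[e e0 eP]; have [m1 m1P] := big e^-1.
  exists (maxn m0 m1) => m; rewrite geq_max => /andP[/m0P/xP[cx xj] /m1P mb].
  apply: eP => //; have Bm : 0 < B + m%:R.
    by apply: lt_trans mb; rewrite invr_gt0.
  apply: (@le_lt_trans _ _ ((B + m%:R)^-1)).
    apply: rnorm_le => [|j]; first by rewrite invr_ge0 ltW.
    by rewrite !mxE xj cnorm_real normfV normrN gtr0_norm.
  by rewrite -[e]invrK ltf_pV2 // posrE ?invr_gt0.
have [M0 M0P] := xcvg _ (filterI hc (open_nbhs_nbhs (conj Uop Up))).
pose M := maxn M0 m0.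
pose K := [set q | q = p \/ exists2 m, (M <= m)%N & q = x m].
have cptK : compact K by exact: compact_sequence_limit xcvg.
have KA q : K q -> S^° (h q) /\ U q.
  case=> [->|[m Mm ->]]; first by rewrite hp.
  by apply: M0P; apply: leq_trans Mm; exact: leq_maxl.
have KU : K `<=` U by move=> q /KA[].
have hKS : h @` K `<=` S^° by move=> _ [q /KA[hq _] <-].
have [n1 _ n1P] := hU K S^° cptK KU (@open_interior _ _) hKS.
pose n := maxn n1 M.
have Mt : (M <= t n)%N.
  apply: leq_trans (increasing_ge_id tinc n); exact: leq_maxr.
have Kx : K (x (t n)) by right; exists (t n).
have /interior_subset/S_petal := n1P n (leq_maxl _ _) _ (imageP _ Kx).
apply; apply: (petal_backward B16 C0 CB gstep).
have [|cx xj] := xP (t n).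
  by apply: m0P; apply: leq_trans Mt; exact: leq_maxr.
split => // j; rewrite xj -fmorphV invrK subrr cnorm0.
by rewrite divr_ge0 ?addr_ge0 ?ler0n // ltW.
Qed.

Lemma holomorphic_at_cst (k p : X) : holomorphic_at (fun _ : X => k) p.
Proof.
split=> [|c d ac ad cp dk]; first exact: cvg_cst.
exists (fun=> d k); split; last by apply: nearW.
by apply: germ_holomorphicT => z; exact: differentiable_cst.
Qed.

Lemma fun_holomorphic_comp (h : X -> X) (u : X -> R[i]) p :
  holomorphic_at h p -> fun_holomorphic_at u (h p) -> fun_holomorphic_at (u \o h) p.
Proof.
move=> [hc hh] uh c ac cp; have [d ad dhp] := atlas_cover (h p).
have [F [Fh hF]] := hh c d ac ad cp dhp; have [G [Gh uG]] := uh d ad dhp.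
have hp := nbhs_singleton hF.
exists (G \o F); split.
  have Fc := differentiable_continuous (nbhs_singleton Fh).
  have GF : \forall z \near c p, differentiable G (F z).
    by rewrite hp in Gh; exact: Fc _ Gh.
  by apply: filterS (filterI Fh GF) => z [/= ? ?]; exact: differentiable_comp.
have uGh : \forall q \near p, u (h q) = G (d (h q)) by exact: hc _ uG.
by apply: filterS (filterI hF uGh) => q [/= <- ].
Qed.

(** The identity theorem for maps into a Stein manifold, by testing against
    the holomorphic functions separating points. *)
Lemma identity_near_map p (A : set X) : stein X -> nbhs p A ->
  exists2 V : set X, nbhs p V & V `<=` A /\ forall (h : X -> X) k,
  (forall q, A q -> holomorphic_at h q) ->
  forall y, V y -> (\forall q \near y, h q = k) -> forall z, V z -> h z = k.
Proof.
move=> [_ sep] /identity_near[V pV [VA Vid]]; exists V => //; split => //.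
move=> h k hh y Vy yk z Vz; apply: contrapT => hzk.
have [u uh] := sep _ _ hzk; apply.
apply: (Vid (u \o h) (u k) _ y Vy) => // [q Aq|].
  by apply: fun_holomorphic_comp; [exact: hh|exact: uh].
by apply: filterS yk => q /= ->.
Qed.

(** * The component of the petal *)

Definition basin (g : X -> X) p : set X :=
  [set q | (fun n => iter n g q) @ \oo --> p].

(** The interior of the basin is relatively closed in the Fatou set: near a
    boundary point all limits of iterates are constant by the identity theorem,
    being constant on an open subset of the basin. *)
Lemma basin_interior_closed (g : X -> X) p : stein X -> forall x, fatou_set g x ->
  closure (basin g p)^° x -> (basin g p)^° x.
Proof.
move=> steinX x [U [Uop Ux Ug]] clx.
have [V xV [VU Vid]] := identity_near_map steinX (open_nbhs_nbhs (conj Uop Ux)).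
have [y [yO Vy]] := clx _ xV.
apply: filterS xV => z Vz; apply/cvg_to_pointP => A pA.
apply: contrapT => nA.
have [s sinc sA] : exists2 s : nat -> nat, increasing_seq s &
    forall k, ~ A (iter (s k) g z).
  apply: (@infinite_increasing (fun n => ~ A (iter n g z))) => n0.
  apply: contrapT => nex; apply: nA.
  exists n0 => n n0n; apply: contrapT => nAn; apply: nex.
  by exists n.
have [t tinc Ht] := Ug s sinc.
have st_ge n : (n <= s (t n))%N.
  by apply: leq_trans (increasing_ge_id tinc n) _; exact: increasing_ge_id.
case: Ht => [[h hh hU]|hU]; last first.
  have /cvg_to_pointP yp : basin g p y by exact: nbhs_singleton.
  have yU : [set y] `<=` U by move=> _ ->; exact: VU.
  have [n1 _ n1P] := hU _ _ (@compact_set1 _ y) yU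
    (compact_sequence_limit (M := 0) yp).
  apply: (n1P n1 (leqnn n1) (iter (s (t n1)) g y)); first by exists y.
  by right; exists (s (t n1)).
have hp y' : U y' -> basin g p y' -> h y' = p.
  move=> Uy' /cvg_to_pointP y'p; apply: contrapT => /eqP hy'p.
  have := @space_hausdorff _ X; rewrite open_hausdorff => /(_ _ _ hy'p).
  move=> [[W1 W2] /= [/set_mem hW1 /set_mem pW2] [W1op W2op /eqP W12]].
  have yU : [set y'] `<=` U by move=> _ ->.
  have hO : h @` [set y'] `<=` W1 by move=> _ [_ -> <-].
  have [n1 _ n1P] := hU _ _ (@compact_set1 _ y') yU W1op hO.
  have [n2 n2P] := y'p W2 (open_nbhs_nbhs (conj W2op pW2)).
  pose n := maxn n1 n2.
  have : (W1 `&` W2) (iter (s (t n)) g y').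
    split; first by apply: (n1P n (leq_maxl _ _)); exists y'.
    by apply: n2P; apply: leq_trans (st_ge n); exact: leq_maxr.
  by rewrite W12.
have hz : h z = p.
  apply: (Vid h p hh y Vy _ z Vz).
  apply: filterS (filterI (near_join yO) (open_nbhs_nbhs (conj Uop (VU _ Vy)))).
  by move=> y' [/nbhs_singleton ? ?]; exact: hp.
have zU : [set z] `<=` U by move=> _ ->; exact: VU.
have hA : h @` [set z] `<=` A^°.
  by move=> _ [_ -> <-]; rewrite hz.
have [n1 _ n1P] := hU _ _ (@compact_set1 _ z) zU (@open_interior _ _) hA.
apply: (sA (t n1)); apply: interior_subset; apply: (n1P n1 (leqnn _)).
by exists z.
Qed.

Lemma fatou_component_not_pre_recurrent (g : X -> X) p q0 : stein X ->
  ~ fatou_set g p -> fatou_set g q0 -> nbhs q0 (basin g p) ->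
  ~ pre_recurrent g (connected_component (fatou_set g) q0).
Proof.
move=> steinX nFp Fq0 q0b [q1 [q2 [q1U Fq2 [s sinc sq2]]]].
set U := connected_component _ _ in q1U.
have UF : U `<=` fatou_set g by exact: connected_component_sub.
have Ub : U `&` (basin g p)^° = U.
  apply: (@component_connected _ (fatou_set g) q0).
  - by exists q0; split; [exact: connected_component_refl|].
  - by exists (basin g p)^° => //; exact: open_interior.
  - exists (closure (basin g p)^°); first exact: closed_closure.
    apply/seteqP; split=> x [Ux xb]; split => //; first exact: subset_closure.
    by apply: basin_interior_closed => //; exact: UF.
have /cvg_to_pointP q1p : basin g p q1.
  by move: q1U; rewrite -Ub => -[_ /nbhs_singleton].
have sq1p : (fun n => iter (s n) g q1) @ \oo --> p.
  apply/cvg_to_pointP => A /q1p[n0 n0P]; exists n0 => n n0n.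
  by apply: n0P; apply: leq_trans n0n _; exact: increasing_ge_id.
apply: nFp; have <- // : q2 = p.
exact: (cvg_unique (@space_hausdorff _ X) sq2 sq1p).
Qed.

(** A parabolic fixed point attracts an open set of points and is not in the
    Fatou set, so the Fatou component of that open set is not pre-recurrent. *)
Lemma parabolic_non_pre_recurrent c p g : (0 < dimX)%N -> stein X -> atlas c ->
  chart_dom c p -> g p = p -> parabolic_at c p g ->
  exists2 U : set X, fatou_component g U & ~ pre_recurrent g U.
Proof.
move=> n0 steinX ac cp gp gpar.
have nFp := parabolic_not_fatou n0 ac cp gp gpar.
have [B [C [B16 C0 CB gstep]]] := petal_step ac cp gpar.
have [a0 a00 a0P] := diagonal_point ac cp.
pose a := B + a0 + 1.
have aB : B <= a by rewrite /a; lra.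
have Na : `|a| = a by rewrite ger0_norm //; lra.
have [|q0 cq0 q0j] := a0P a; first by rewrite Na /a; lra.
have r0 : 0 < 1 - C / (a - 1).
  rewrite subr_gt0 ltr_pdivrMr; lra.
have an0 : a != 0 by rewrite gt_eqF //; lra.
have q0a := petal_nbhs ac cq0 r0 an0 q0j.
have attr := petal_attracted B16 C0 gstep ac cp aB.
have Fq0 : fatou_set g q0.
  exists (petal c p a (1 - C / (a - 1)))^°; split => //.
    exact: open_interior.
  move=> s sinc; exists (fun n => n); first exact: increasing_id.
  left; exists (fun=> p); first by move=> q _; exact: holomorphic_at_cst.
  move=> K O _ KU Oop KO; have [K0|K0] := pselect (K !=set0); last first.
    by exists 0%N => // n _ t [q Kq _]; case: K0; exists q.
  have Op : O p by case: K0 => q Kq; apply: KO; exists q.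
  have [n1 n1P] := attr _ (open_nbhs_nbhs (conj Oop Op)).
  exists n1 => // n n1n _ [q Kq <-]; apply: n1P.
    by apply: leq_trans n1n _; exact: increasing_ge_id.
  exact: interior_subset (KU _ Kq).
exists (connected_component (fatou_set g) q0); first by exists q0.
apply: (@fatou_component_not_pre_recurrent g p) => //.
apply: filterS q0a => q qa; apply/cvg_to_pointP => A /attr[n1 n1P].
by exists n1 => n n1n; exact: n1P.
Qed.

End manifold.

(** * Density *)

(** The compact-open neighbourhoods of [f] control the graph over one compact
    set, which is the form of approximation provided by the Oka property. *)
Lemma compact_open_graph_nbhs (T : topologicalType) (f : T -> T)
    (A : set {compact-open, T -> T}) : hausdorff_space T ->
  nbhs (f : {compact-open, T -> T}) A ->
  exists (K : set T) (V : set (T * T)), [/\ compact K, open V,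
    (forall p, K p -> V (p, f p)) &
    forall g : T -> T, (forall p, K p -> V (p, g p)) -> A g].
Proof.
move=> hausT.
pose F : set_system {compact-open, T -> T} := [set A | exists (K : set T)
  (V : set (T * T)), [/\ compact K, open V, (forall p, K p -> V (p, f p)) &
    forall g : T -> T, (forall p, K p -> V (p, g p)) -> A g]].
have FF : Filter F.
  split.
  - exists set0, setT; split => //; [exact: compact0|exact: openT].
  - move=> A1 A2 [K1 [V1 [cpt1 V1op fV1 A1P]]] [K2 [V2 [cpt2 V2op fV2 A2P]]].
    exists (K1 `|` K2), (((fst @^-1` ~` K1) `|` V1) `&` ((fst @^-1` ~` K2) `|` V2)).
    have clop K : compact K -> open ((@fst T T) @^-1` ~` K).
      move=> cptK; apply: open_comp; first by move=> ? _; exact: cvg_fst.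
      by apply: closed_openC; exact: compact_closed.
    split.
    + by apply: compactU.
    + by apply: openI; apply: openU => //; exact: clop.
    + move=> p _; split => /=.
        by have [/fV1|] := pselect (K1 p); [right|left].
      by have [/fV2|] := pselect (K2 p); [right|left].
    + move=> g gV; split.
        by apply: A1P => p Kp; have [[nKp|//] _] := gV p (or_introl Kp).
      by apply: A2P => p Kp; have [_ [nKp|//]] := gV p (or_intror Kp).
  - move=> A1 A2 A12 [K [V [cptK Vop fV A1P]]]; exists K, V; split => //.
    by move=> g /A1P/A12.
have : F --> (f : {compact-open, T -> T}).
  apply/compact_open_cvgP => K W cptK Wop fKW.
  exists K, (snd @^-1` W); split => //.
  - by apply: open_comp => // ? _; exact: cvg_snd.
  - by move=> p Kp; apply: fKW; exists p.
  - by move=> g gW _ [p Kp <-]; exact: gW.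
by move=> FA /FA.
Qed.

Lemma holomorphic_hull_sub (R : realType) (X : complex_space R) (K : set X) :
  K `<=` holomorphic_hull K.
Proof. by move=> p Kp u _ M KM; exact: KM. Qed.

Lemma holomorphic_hull_convex (R : realType) (X : complex_space R) (K : set X) :
  holomorphically_convex (holomorphic_hull K).
Proof.
apply/seteqP; split; last exact: holomorphic_hull_sub.
move=> p hp u uh M KM; apply: hp => // q hq; exact: hq.
Qed.

(* The set is contained in [endomorphisms X], so that inclusion of
   [endomorphisms X] in its closure in the compact-open topology on X -> X is
   density in the subspace [endomorphisms X]. *)
Theorem theorem5 (R : realType) (X : complex_space R)
    (hX : oka_stein_manifold X) :
  endomorphisms X `<=`
  closure ([set f | endomorphisms X f /\
                    exists2 U : set X, fatou_component f U
                                     & ~ pre_recurrent f U]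
           : set {compact-open, X -> X}).
Proof.
case: hX => -[n n0 manX] X0 conX okaX steinX f fhol A fA.
have [K0 [V [cptK0 Vop fV VA]]] :=
  compact_open_graph_nbhs (@space_hausdorff _ X) fA.
pose K := holomorphic_hull K0.
have cptK : compact K by exact: steinX.1.
have [p nKp] : exists p, ~ K p.
  apply: contrapT => nex; apply: (stein_not_compact manX n0 X0 conX steinX).
  suff <- : K = setT by [].
  by apply/seteqP; split => // p _; apply: contrapT => nKp; apply: nex; exists p.
have [c ac cp] := atlas_cover p.
have [m [mh mp mc]] := parabolic_germ manX ac cp.
(* The graph is constrained over [K0], not over the rest of its hull. *)
pose V' := V `|` (fst @^-1` ~` K0).
have V'op : open V'.
  apply: openU => //; apply: open_comp; first by move=> ? _; exact: cvg_fst.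
  by apply: closed_openC; apply: compact_closed => //; exact: space_hausdorff.
have fV' q : K q -> V' (q, f q).
  by move=> _; have [/fV|] := pselect (K0 q); [left|right].
have [g [gh gV gp gm]] := oka_interpolation manX 3 okaX steinX conX cptK
  (@holomorphic_hull_convex R X K0) nKp fhol mh V'op fV'.
rewrite mp in gp gm.
exists g; split; last first.
  apply: VA => q Kq; have [//|] := gV q (holomorphic_hull_sub Kq).
  by move=> /(_ Kq).
split => //; apply: (parabolic_non_pre_recurrent manX n0 steinX ac cp gp).
have /choice[B BP] : forall j, exists B : R, 0 <= B /\ \forall q \near p,
    N (c (g q) ord0 j - c (m q) ord0 j) <= B * rnorm (c q - c p) ^+ 4.
  move=> j; have [B B0 BP] := ideal_power_bound ac cp (gm c ac cp j).
  by exists B.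
have gc : \forall q \near p, chart_dom c (g q).
  have [gcp _] := gh p; apply: gcp; rewrite gp.
  have [cop _ _ _ _] := atlas_chart ac.
  exact: open_nbhs_nbhs.
exists (\sum_j B j); first by apply: sumr_ge0 => j _; case: (BP j).
have Bnear : \forall q \near p, forall j,
    N (c (g q) ord0 j - c (m q) ord0 j) <= B j * rnorm (c q - c p) ^+ 4.
  by apply: filter_forall => j; case: (BP j).
apply: filterS (filterI gc (filterI mc Bnear)) => q [gq [[mq mqP] qB]].
split=> // j; rewrite -mqP; apply: le_trans (qB j) _.
rewrite ler_wpM2r ?exprn_ge0 ?rnorm_ge0 // (bigD1 j) //= lerDl.
by apply: sumr_ge0 => i _; case: (BP i).
Qed.
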